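(* There is a deterministic polynomial-time algorithm that, given a finite grid $S=S_1\times\cdots\times S_m\subseteq\mathbb{F}^m$, a downset $\mathcal{D}\subseteq\mathcal{M}$, and a weighted received word $w:S\to\mathbb{F}\times[0,1]$, outputs a codeword $C\in\mathcal{C}(S,\mathcal{D})$ such that $\Delta(w,C)<\mu(S,\mathcal{D})/2$, whenever such a codeword exists. (If no such codeword exists, the algorithm outputs some arbitrary polynomial.)
   Context: $\mathbb{F}$ is a field, $S_1,\ldots,S_m\subseteq\mathbb{F}$ are finite non-empty sets with $k_i=|S_i|$, and $\mathcal{M}=\{0,\ldots,k_1-1\}\times\cdots\times\{0,\ldots,k_m-1\}$ with the componentwise partial order; exponent vectors $\alpha$ are identified with monomials $X_1^{\alpha_1}\cdots X_m^{\alpha_m}$. A downset $\mathcal{D}\subseteq\mathcal{M}$ is a set closed under taking componentwise-smaller elements (the monomials are closed under taking factors). The downset code $\mathcal{C}(S,\mathcal{D})$ is the set of functions $f:S\to\mathbb{F}$ that can be represented by a linear combination of monomials from $\mathcal{D}$ (codewords are output as such polynomials). $\mu(S,\mathcal{D})$ is the minimum distance of $\mathcal{C}(S,\mathcal{D})$, i.e. the minimum number of points of $S$ where a nonzero codeword is nonzero. A weighted received word is a pair $w=(f,u)$ with $f:S\to\mathbb{F}$ and $u:S\to[0,1]$, and for $g:S\to\mathbb{F}$ its distance is \[\Delta(w,g)=\sum_{\mathbf{x}:f(\mathbf{x})=g(\mathbf{x})}\frac{u(\mathbf{x})}{2}+\sum_{\mathbf{x}:f(\mathbf{x})\neq g(\mathbf{x})}\Big(1-\frac{u(\mathbf{x})}{2}\Big).\]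 An unweighted word $h$ is identified with $(h,0)$, for which this is the Hamming distance. *)

(* Defs.v *)
From HB Require Import structures.
From mathcomp Require Import all_boot all_order all_algebra.
From mathcomp Require Import mpoly.

Set Implicit Arguments.
Unset Strict Implicit.
Unset Printing Implicit Defensive.

Import Order.TTheory GRing.Theory Num.Theory.
Local Open Scope ring_scope.

(* Downset codes over a finite grid.

   A finite non-empty set S_i of field elements is given by a duplicate-free
   listing, in any order. A function on the grid S_1 x ... x S_m is given by a
   function on F^m, of which only the values on [points S] are ever used. *)

Section Codes.
Variables (F : fieldType) (R : realFieldType).

Definition is_grid m (S : m.-tuple (seq F)) : Prop :=
  forall i, uniq (tnth S i) /\ tnth S i <> [::].

(* The points of the grid in lexicographic order of the listings. *)
Fixpoint points m : m.-tuple (seq F) -> seq (m.-tuple F) :=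
  match m with
  | 0 => fun _ => [:: [tuple]]
  | m'.+1 => fun S : m'.+1.-tuple (seq F) =>
      [seq [tuple of a :: tval x] | a : F <- thead S,
                                    x : m'.-tuple F <- points (behead_tuple S)]
  end.

Definition is_downset m (S : m.-tuple (seq F)) (D : seq 'X_{1..m}) : Prop :=
  [/\ uniq D,
      forall a, a \in D -> forall i, (a i < size (tnth S i))%N
    & forall a b : 'X_{1..m}, b \in D -> (a <= b)%MM -> a \in D].

Definition in_span m (D : seq 'X_{1..m}) (p : {mpoly F[m]}) : Prop :=
  {subset msupp p <= D}.

Definition codeword m (S : m.-tuple (seq F)) (D : seq 'X_{1..m})
    (g : m.-tuple F -> F) : Prop :=
  exists2 p : {mpoly F[m]}, in_span D p
    & {in points S, forall x, g x = p.@[tnth x]}.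

Definition hweight m (S : m.-tuple (seq F)) (g : m.-tuple F -> F) : nat :=
  count (fun x => g x != 0) (points S).

Definition nonzero_on m (S : m.-tuple (seq F)) (g : m.-tuple F -> F) : Prop :=
  exists2 x, x \in points S & g x != 0.

(* [is_min_distance S D mu] says that mu is the minimum of the weights of the
   nonzero codewords; no mu satisfies it for the code {0} of the empty D. *)
Definition is_min_distance m (S : m.-tuple (seq F)) (D : seq 'X_{1..m})
    (mu : nat) : Prop :=
  (exists g, [/\ codeword S D g, nonzero_on S g & hweight S g = mu]) /\
  (forall g, codeword S D g -> nonzero_on S g -> (mu <= hweight S g)%N).

Definition is_wword m (S : m.-tuple (seq F)) (w : m.-tuple F -> F * R) : Prop :=
  {in points S, forall x, 0 <= (w x).2 <= 1}.

Definition wdist m (S : m.-tuple (seq F)) (w : m.-tuple F -> F * R)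
    (g : m.-tuple F -> F) : R :=
  \sum_(x <- points S | (w x).1 == g x) (w x).2 / 2 +
  \sum_(x <- points S | (w x).1 != g x) (1 - (w x).2 / 2).

Definition poly_of_terms m (ts : seq ('X_{1..m} * F)) : {mpoly F[m]} :=
  \sum_(t <- ts) t.2 *: 'X_[t.1].

End Codes.

(* The model of computation: a first-order LISP over binary trees whose leaves
   are nil, field elements or weights. A program is a finite list of mutually
   recursive one-argument functions; variables are de Bruijn indices into the
   environment. Programs mention no field or weight constant except 0 and 1, and
   time is the number of evaluation steps.

   As usual for algorithms over an arbitrary field, an arithmetic operation or
   equality test in F is one step. Weights only admit addition, subtraction,
   comparison and division by an integer given in unary (charged its value), so
   on rational weights the bit length of every weight computed stays polynomial
   in the bit length of the input and the number of steps. *)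

Inductive fop := FAdd | FSub | FMul | FDiv.
Inductive wop := WAdd | WSub.

Inductive expr :=
| EVar of nat
| ELet of expr & expr
| ENil
| EPair of expr & expr
| ECase of expr & expr & expr
| ECall of nat & expr
| EFConst of bool
| EFOp of fop & expr & expr
| EFEq of expr & expr
| EWConst of bool
| EWOp of wop & expr & expr
| EWDivn of expr & expr
| EWLe of expr & expr.

Definition program := seq expr.

Section Machine.
Variables (F : fieldType) (R : realFieldType).

Inductive value :=
| VNil
| VField of F
| VWeight of R
| VPair of value & value.

Fixpoint value_size (v : value) : nat :=
  if v is VPair a b then (value_size a + value_size b).+1 else 1.

Definition enc_seq (vs : seq value) : value := foldr VPair VNil vs.
Definition enc_nat (n : nat) : value := enc_seq (nseq n VNil).
Definition enc_bool (b : bool) : value := enc_nat b.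

Definition fop_eval (o : fop) (x y : F) : F :=
  match o with
  | FAdd => x + y | FSub => x - y | FMul => x * y | FDiv => x / y
  end.

Definition wop_eval (o : wop) (x y : R) : R :=
  match o with WAdd => x + y | WSub => x - y end.

(* [eval P env e v t]: under P, expression e evaluates to v in t steps. An
   expression applied to values of the wrong shape has no evaluation. *)
Inductive eval (P : program) : seq value -> expr -> value -> nat -> Prop :=
| eval_var env i v : onth env i = Some v -> eval P env (EVar i) v 1
| eval_let env e1 e2 v1 v2 t1 t2 :
    eval P env e1 v1 t1 -> eval P (v1 :: env) e2 v2 t2 ->
    eval P env (ELet e1 e2) v2 (t1 + t2).+1
| eval_nil env : eval P env ENil VNil 1
| eval_pair env e1 e2 v1 v2 t1 t2 :
    eval P env e1 v1 t1 -> eval P env e2 v2 t2 ->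
    eval P env (EPair e1 e2) (VPair v1 v2) (t1 + t2).+1
| eval_case_nil env e e1 e2 v t t1 :
    eval P env e VNil t -> eval P env e1 v t1 ->
    eval P env (ECase e e1 e2) v (t + t1).+1
| eval_case_pair env e e1 e2 a b v t t2 :
    eval P env e (VPair a b) t -> eval P (a :: b :: env) e2 v t2 ->
    eval P env (ECase e e1 e2) v (t + t2).+1
| eval_call env k body e v1 v2 t1 t2 :
    onth P k = Some body ->
    eval P env e v1 t1 -> eval P [:: v1] body v2 t2 ->
    eval P env (ECall k e) v2 (t1 + t2).+1
| eval_fconst env (b : bool) : eval P env (EFConst b) (VField b%:R) 1
| eval_fop env o e1 e2 x1 x2 t1 t2 :
    eval P env e1 (VField x1) t1 -> eval P env e2 (VField x2) t2 ->
    eval P env (EFOp o e1 e2) (VField (fop_eval o x1 x2)) (t1 + t2).+1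
| eval_feq env e1 e2 x1 x2 t1 t2 :
    eval P env e1 (VField x1) t1 -> eval P env e2 (VField x2) t2 ->
    eval P env (EFEq e1 e2) (enc_bool (x1 == x2)) (t1 + t2).+1
| eval_wconst env (b : bool) : eval P env (EWConst b) (VWeight b%:R) 1
| eval_wop env o e1 e2 x1 x2 t1 t2 :
    eval P env e1 (VWeight x1) t1 -> eval P env e2 (VWeight x2) t2 ->
    eval P env (EWOp o e1 e2) (VWeight (wop_eval o x1 x2)) (t1 + t2).+1
| eval_wdivn env e1 e2 x n t1 t2 :
    eval P env e1 (VWeight x) t1 -> eval P env e2 (enc_nat n) t2 ->
    eval P env (EWDivn e1 e2) (VWeight (x / n%:R)) (t1 + t2 + n).+1
| eval_wle env e1 e2 x1 x2 t1 t2 :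
    eval P env e1 (VWeight x1) t1 -> eval P env e2 (VWeight x2) t2 ->
    eval P env (EWLe e1 e2) (enc_bool (x1 <= x2)) (t1 + t2).+1.

Definition runs (P : program) (input output : value) (t : nat) : Prop :=
  eval P [:: input] (ECall 0 (EVar 0)) output t.

Lemma enc_nat_inj : injective enc_nat.
Proof. by elim=> [|n IHn] [|k] //= [] /IHn ->. Qed.

Lemma eval_det P env e v v' t t' :
  eval P env e v t -> eval P env e v' t' -> v = v' /\ t = t'.
Proof.
move=> E; elim: E v' t' => {env e v t}; intros; repeat match goal with
  | _ : forall v' t', eval ?P ?env ?e v' t' -> ?v = v' /\ ?t = t',
    H : eval ?P ?env ?e ?v ?t |- _ => clear H
  end; match goal with
  | H : eval _ _ _ ?v' ?t' |- _ = ?v' /\ _ = ?t' => inversion H; subst; clear H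
  end; repeat match goal with
  | IH : forall v t, eval ?P ?env ?e v t -> _, H : eval ?P ?env ?e _ _ |- _ =>
    let Ev := fresh "Ev" in have [Ev ?] := IH _ _ H; clear H IH; subst;
    first [discriminate Ev | injection Ev as; subst | idtac]
  | H : onth ?s ?i = Some _, H' : onth ?s ?i = Some _ |- _ =>
    rewrite H in H'; injection H' as; subst
  | H : enc_nat _ = enc_nat _ |- _ => move/enc_nat_inj: H => H; subst
  end; by [].
Qed.

Definition enc_mnm m (a : 'X_{1..m}) : value :=
  enc_seq [seq enc_nat (a i) | i <- enum 'I_m].

(* The word is given by its table of values, in the order of [points S]. *)
Definition enc_instance m (S : m.-tuple (seq F)) (D : seq 'X_{1..m})
    (w : m.-tuple F -> F * R) : value :=
  VPair (enc_seq [seq enc_seq [seq VField a | a <- s] | s <- S])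
 (VPair (enc_seq [seq enc_mnm a | a <- D])
        (enc_seq [seq VPair (VField (w x).1) (VWeight (w x).2)
                 | x <- points S])).

Definition enc_terms m (ts : seq ('X_{1..m} * F)) : value :=
  enc_seq [seq VPair (enc_mnm t.1) (VField t.2) | t <- ts].

End Machine.

(* Main.v *)
Require Import Defs.
From HB Require Import structures.
From mathcomp Require Import all_boot all_order all_algebra.
From mathcomp Require Import mpoly zify ring lra.

Set Implicit Arguments.
Unset Strict Implicit.
Unset Printing Implicit Defensive.

Import Order.TTheory GRing.Theory Num.Theory.
Local Open Scope ring_scope.

(* A codeword is P = sum_j P_j X_m^j, where P_j lies in the downset code of the
   slice D_j of the exponents whose last entry is j. The P_j are found from
   j = k_m - 1 down to 0 (Kim and Kopparty): once the higher ones have been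
   subtracted from the word, each column (the points that agree outside the last
   coordinate) is decoded as a univariate word of degree at most j, and the
   coefficient of X_m^j found, weighted by twice the distance from the column
   divided by k_m - j, is one symbol of a word w' over the smaller grid. A case
   analysis in each column gives Delta(w', P_j) <= Delta(w, P) / (k_m - j), while
   multiplying by a product of j linear factors in X_m shows that
   mu(S, D) <= (k_m - j) mu(S', D_j); so P_j is found by recursion. The slices
   have |D| elements in total, hence the recursion tree is small.

   A weighted univariate word is decoded by adding its points one at a time, by
   increasing weight, to a Welch-Berlekamp interpolation and testing the
   candidate found after each point (Forney's generalized minimum distance). *)

(** * Polynomials as coefficient lists *)

(** The program never computes the minimum distance. The only radius it uses is the number k_m - j
    belonging to a column, which the grid gives; mu occurs in the proof alone, as a lower bound on
    weights that is divided by k_m - j at each level of the recursion.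

    Distances are doubled: a point contributes u where word and codeword agree and 2 - u where they
    differ, and the radius becomes mu instead of mu / 2. A column without a close polynomial yields
    a symbol of weight 1. This is an erasure, since it contributes 1 whatever the true symbol is.

    A candidate for a column is accepted because of its distance from the whole column, not because
    of how it was found. Two distinct polynomials of degree at most j have doubled distances adding
    up to at least 2 (k_m - j), so at most one of them is within the radius. The interpolation may
    therefore return a meaningless candidate on some prefixes; it only has to return the right one
    on a single prefix. *)

Section ListPolynomials.
Variable F : fieldType.
Implicit Types (p q A B hs : seq F) (a c : F).

Fixpoint padd p q :=
  match p, q with
  | [::], _ => q
  | _, [::] => p
  | x :: p', y :: q' => x + y :: padd p' q'
  end.

Definition pscale c p := [seq c * x | x <- p].
Definition pcomb c p d q := padd (pscale c p) (pscale d q).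
Definition pmulX a p := padd (0 :: p) (pscale (0 - a) p).

(** Division of power series needs an invertible constant coefficient, so the power of X in B is
    taken out of both lists. If A + B h = 0, the same power divides A, and the heads dropped from A
    are zero. *)
Fixpoint strip A B :=
  if B is y :: B' then if y == 0 then strip (behead A) B' else (A, B)
  else (A, B).

(* The first n coefficients of the power series - A / B, provided the constant
   coefficient of B is not zero. *)
Fixpoint neg_sdiv n A B :=
  if n is n'.+1 then
    let g0 := (0 - head 0 A) / head 0 B in
    g0 :: neg_sdiv n' (behead (padd A (pscale g0 B))) B
  else [::].

Lemma Poly_cons c p : Poly (c :: p) = Poly p * 'X + c%:P.
Proof. by rewrite /= cons_poly_def. Qed.

Lemma Poly_padd p q : Poly (padd p q) = Poly p + Poly q.
Proof.
elim: p q => [|x p IHp] [|y q]; rewrite ?add0r ?addr0 //.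
by rewrite [padd _ _]/= !Poly_cons IHp polyCD; ring.
Qed.

Lemma Poly_pscale c p : Poly (pscale c p) = c *: Poly p.
Proof.
elim: p => [|x p IHp]; first by rewrite scaler0.
by rewrite !Poly_cons IHp scalerDr scalerAl -!mul_polyC polyCM.
Qed.

Lemma Poly_pcomb c p d q : Poly (pcomb c p d q) = c *: Poly p + d *: Poly q.
Proof. by rewrite Poly_padd !Poly_pscale. Qed.

Lemma Poly_pmulX a p : Poly (pmulX a p) = ('X - a%:P) * Poly p.
Proof.
rewrite Poly_padd Poly_pscale Poly_cons addr0 sub0r scaleNr -mul_polyC.
by rewrite mulrBl [_ * 'X]mulrC.
Qed.

Lemma size_padd p q : size (padd p q) = maxn (size p) (size q).
Proof. by elim: p q => [|x p IHp] [|y q] //=; rewrite IHp maxnSS. Qed.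

Lemma size_pscale c p : size (pscale c p) = size p.
Proof. exact: size_map. Qed.

Lemma size_pcomb c p d q : size (pcomb c p d q) = maxn (size p) (size q).
Proof. by rewrite size_padd !size_pscale. Qed.

Lemma size_pmulX a p : size (pmulX a p) = (size p).+1.
Proof. by rewrite size_padd size_pscale /= maxnE; lia. Qed.

Lemma size_strip A B :
  (size (strip A B).1 <= size A)%N /\ (size (strip A B).2 <= size B)%N.
Proof.
elim: B A => [|y B IHB] A //=; case: eqP => // _.
have [le1 le2] := IHB (behead A); rewrite size_behead in le1; split; lia.
Qed.

Lemma size_neg_sdiv n A B : size (neg_sdiv n A B) = n.
Proof. by elim: n A => //= n IHn A; rewrite IHn. Qed.

Lemma Poly_head_behead A : Poly A = Poly (behead A) * 'X + (head 0 A)%:P.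
Proof. by case: A => [|x A]; rewrite /= ?mul0r ?add0r // cons_poly_def. Qed.

Lemma strip_correct A B (h : {poly F}) :
    Poly A + Poly B * h = 0 -> Poly B != 0 ->
  let: (A', B') := strip A B in
  Poly A' + Poly B' * h = 0 /\ head 0 B' != 0.
Proof.
elim: B A => [|y B IHB] A /=; first by rewrite eqxx.
case: (eqVneq y 0) => [->|nz_y] //; rewrite cons_poly_def addr0 => AB0 nzB.
apply: IHB; last by apply: contraNneq nzB => ->; rewrite mul0r.
have A0: head 0 A = 0.
  have /(congr1 (horner_eval 0)) := AB0; rewrite Poly_head_behead.
  by rewrite /horner_eval !hornerE.
apply: (mulIf (negbT (polyX_eq0 F))); rewrite mul0r -[RHS]AB0 [in RHS]Poly_head_behead.
by rewrite A0; ring.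
Qed.

(** The constant coefficients of the relation determine the head x of [hs]. Adding x B to A makes
    the constant coefficient vanish, and cancelling X leaves the same relation, with the same B, for
    the tail. *)
Lemma neg_sdiv_correct A B hs :
  head 0 B != 0 -> Poly A + Poly B * Poly hs = 0 -> neg_sdiv (size hs) A B = hs.
Proof.
move=> nzB; elim: hs A => //= x hs IHhs A; rewrite cons_poly_def => AB0.
have Dx: (0 - head 0 A) / head 0 B = x.
  have /(congr1 (horner_eval 0)) := AB0.
  rewrite (Poly_head_behead A) (Poly_head_behead B) /horner_eval !hornerE /=.
  by move=> /eqP; rewrite addr_eq0 => /eqP ->; field.
rewrite Dx; congr (_ :: _); apply: IHhs; apply: (mulIf (negbT (polyX_eq0 F))).
set A' := padd _ _; have DA': Poly A' = Poly (behead A') * 'X.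
  have A'0: head 0 A' = 0.
    rewrite /A' -Dx /pscale.
    by case: (A) (B) nzB => [|u A1] [|v B1] //= nzv; rewrite ?eqxx // in nzv *; field.
  by rewrite Poly_head_behead A'0 addr0.
rewrite mul0r mulrDl -DA' -[RHS]AB0 Poly_padd Poly_pscale -mul_polyC; ring.
Qed.

End ListPolynomials.

(** * Weighted univariate decoding *)

Section Univariate.
Variables (F : fieldType) (R : realFieldType).
Notation point := (F * (F * R))%type.
Notation poly2 := (seq F * seq F)%type.
Implicit Types (p col l rest : seq point) (t : point) (g : seq F).
Implicit Types (h : {poly F}) (j e : nat).

(* Twice the contribution of a point to [wdist]. *)
Definition gap (w : F * R) (y : F) : R := if w.1 == y then w.2 else 2 - w.2.

Definition dist_on col (f : F -> F) : R := \sum_(t <- col) gap t.2 (f t.1).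

Definition wb_init j : poly2 * (poly2 * nat) :=
  (([:: 1], [::]), (([::], [:: 1]), j)).

Definition wb_eval (Q : poly2) (a f : F) : F :=
  horner_rec Q.1 a + horner_rec Q.2 a * f.

Definition wb_mulX a (Q : poly2) : poly2 := (pmulX a Q.1, pmulX a Q.2).

Definition wb_comb c (Q : poly2) d (Q' : poly2) : poly2 :=
  (pcomb c Q.1 d Q'.1, pcomb c Q.2 d Q'.2).

(* A pair Q = (A, B) stands for A + B Y. The state consists of two such pairs,
   vanishing on the points (a, f) treated so far, and of the difference d >= 0 of
   their degrees, where Y has degree j. A step makes both vanish at one more
   point while raising only one of the two degrees, by one. *)
Definition wb_step (st : poly2 * (poly2 * nat)) (a f : F) :=
  let: (Q1, (Q2, d)) := st in
  let c := wb_eval Q1 a f in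
  if c == 0 then (Q1, (wb_mulX a Q2, d.+1)) else
  let Q2' := wb_comb c Q2 (0 - wb_eval Q2 a f) Q1 in
  if d is d'.+1 then (wb_mulX a Q1, (Q2', d')) else (Q2', (wb_mulX a Q1, 1%N)).

Definition wb_cand j (Q : poly2) : seq F :=
  let AB := strip Q.1 Q.2 in neg_sdiv j.+1 AB.1 AB.2.

(** With e = size col - j, at most one polynomial of degree at most j passes the test v < 1, so it
    does not matter which prefix produced it. The default (0, 1) is an erasure: weight 1 makes the
    gap equal to 1 for every symbol. *)
Fixpoint wb_loop col j e st rest : F * R :=
  if rest is t :: rest' then
    let st' := wb_step st t.1 t.2.1 in
    let g := wb_cand j st'.1 in
    let v := dist_on col (horner_rec g) / e%:R in
    if 1 <= v then wb_loop col j e st' rest' else (last 0 g, v)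
  else (0, 1).

Fixpoint insert t l :=
  if l is t' :: l' then
    if t.2.2 <= t'.2.2 then t :: l else t' :: insert t l'
  else [:: t].

Fixpoint insertion_sort l :=
  if l is t :: l' then insert t (insertion_sort l') else [::].

Definition udecode j e col : F * R :=
  wb_loop col j e (wb_init j) (insertion_sort col).

(** * Points sorted by weight *)

Definition le_weight t t' := t.2.2 <= t'.2.2.

Lemma perm_insert t l : perm_eq (insert t l) (t :: l).
Proof.
elim: l => //= t' l IHl; case: ifP => // _.
by rewrite -[t :: _]/([:: t] ++ t' :: l) perm_sym perm_catC /= perm_cons
           perm_catC /= perm_sym.
Qed.

Lemma perm_insertion_sort l : perm_eq (insertion_sort l) l.
Proof.
elim: l => //= t l IHl; apply: perm_trans (perm_insert _ _) _.
by rewrite perm_cons.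
Qed.

Lemma sorted_insertion_sort l : sorted le_weight (insertion_sort l).
Proof.
have path_insert t t1 l1 : le_weight t1 t -> path le_weight t1 l1 ->
    path le_weight t1 (insert t l1).
  elim: l1 t1 => [|t2 l1 IHl1] t1 le1 /=; first by rewrite le1.
  case/andP=> le12 st2; case: ifP => [le_t | /negbT]; rewrite /= ?le1 ?le12 //=.
    by rewrite /le_weight le_t.
  by rewrite -ltNge => /ltW lt_t; apply: IHl1.
elim: l => //= t l; case: (insertion_sort l) => //= t1 l1 st.
case: ifP => [le_t | /negbT]; first by rewrite /= st /le_weight le_t.
by rewrite -ltNge => /ltW lt_t; apply: path_insert.
Qed.

(* Forney's generalized minimum distance argument: the sum is affine in the
   weights and the extreme points of 0 <= u_1 <= ... <= u_k <= 1 are the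
   thresholds 0, ..., 0, 1, ..., 1. *)
Lemma sorted_weight_sum_ge (err : pred point) l (lo d : R) :
    sorted le_weight l -> all (fun t => lo <= t.2.2 <= 1) l ->
    0 <= lo <= 1 ->
    (forall q, (q <= size l)%N ->
      d <= 2 * (count err (take q l))%:R + (size l)%:R - q%:R) ->
  lo * (size l)%:R + (1 - lo) * d
    <= \sum_(t <- l) (if err t then 2 - t.2.2 else t.2.2).
Proof.
elim: l lo d => [|t l IHl] lo d /= srt; rewrite ?big_nil ?big_cons.
  move=> _ lo01 /(_ 0 (leqnn _)) /=; nra.
case/andP=> t01 all01 lo01 ge_d.
(* The induction hypothesis is used with lo equal to the weight of t, which bounds the later weights
   because the list is sorted, and with d - 2 b, because t adds 2 b at every threshold q >= 1. The
   threshold q = 0 gives d <= size l + 1, the second factor of the product below. *)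
pose b : R := (err t)%:R.
have /(IHl _ (d - 2 * b) (path_sorted srt)): all (fun t' => t.2.2 <= t'.2.2 <= 1) l.
  apply/allP=> t' lt'; have /andP[_ ->] := allP all01 _ lt'; rewrite andbT.
  by have /allP := order_path_min (fun _ _ _ => @le_trans _ _ _ _ _) srt; apply.
have t01': 0 <= t.2.2 <= 1 by lra.
move/(_ t01'); have {}ge_d0 := ge_d 0 isT; have {}ge_d q leql := ge_d q.+1 leql.
move/(_ _)/wrap; case=> [q leql|].
  by have:= ge_d q leql; rewrite natrD /b -!natr1; lra.
rewrite /= -natr1 mulr0 add0r subr0 in ge_d0 *.
have: 0 <= (t.2.2 - lo) * ((size l)%:R + 1 - d) by rewrite mulr_ge0 //; lra.
have: b = 1 /\ err t \/ b = 0 /\ ~~ err t by rewrite /b; case: (err t); [left|right].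
case=> -[Eb]; [move=> -> | move/negPf->]; rewrite Eb; nra.
Qed.

(* The degrees are only bounded after substituting h for Y, which is all that
   the decoding of h needs. By 2 r + d = size p + j, the first pair has degree at
   most (size p + j) / 2, less than the number of points of p where h agrees with
   the word as soon as there are few errors. *)
Definition wb_inv j h p (st : poly2 * (poly2 * nat)) :=
  let: (Q1, (Q2, d)) := st in
  exists r : nat,
  [/\ (2 * r + d = size p + j)%N,
      (size (Poly Q1.1 + Poly Q1.2 * h)%R <= r.+1)%N,
      (size (Poly Q2.1 + Poly Q2.2 * h)%R <= (r + d).+1)%N,
      Poly Q1.1 * Poly Q2.2 - Poly Q2.1 * Poly Q1.2 != 0
    & {in p, forall t, wb_eval Q1 t.1 t.2.1 = 0 /\ wb_eval Q2 t.1 t.2.1 = 0}].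

Lemma wb_inv_init j h : (size h <= j.+1)%N -> wb_inv j h [::] (wb_init j).
Proof.
move=> szh; exists 0%N; rewrite /= !cons_poly_def !mul0r !add0r !addr0 mul1r.
by split; rewrite ?size_poly1 ?add0n // !mulr1 subr0 oner_eq0.
Qed.

Lemma wb_eval_mulX a Q x f : wb_eval (wb_mulX a Q) x f = (x - a) * wb_eval Q x f.
Proof.
rewrite /wb_eval -!horner_Poly !Poly_pmulX !hornerE; ring.
Qed.

Lemma wb_eval_comb c Q d Q' x f :
  wb_eval (wb_comb c Q d Q') x f = c * wb_eval Q x f + d * wb_eval Q' x f.
Proof.
rewrite /wb_eval -!horner_Poly !Poly_pcomb !hornerE; ring.
Qed.

Lemma size_XsubCM a h : (size (('X - a%:P) * h)%R <= (size h).+1)%N.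
Proof. by apply: leq_trans (size_polyMleq _ _) _; rewrite size_XsubC. Qed.

(** Every branch multiplies the determinant by X - a, up to a nonzero constant, so it stays nonzero.
    The combination cancels the two values at the new point. When d = 0 it keeps the degree bound r
    while the other pair rises to r + 1, hence the exchange of the two. *)
Lemma wb_inv_step j h p st t :
  wb_inv j h p st -> wb_inv j h (rcons p t) (wb_step st t.1 t.2.1).
Proof.
case: st => Q1 [Q2 d] [r [def_r sz1 sz2 det0 van]] /=.
case: (eqVneq (wb_eval Q1 _ _) 0) => [c0 | nzc].
  exists r; split=> //.
  - by rewrite size_rcons; lia.
  - rewrite !Poly_pmulX -mulrA -mulrDr.
    by apply: leq_trans (size_XsubCM _ _) _; rewrite addnS ltnS.
  - rewrite [X in X != _](_ : _ = ('X - t.1%:P) *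
      (Poly Q1.1 * Poly Q2.2 - Poly Q2.1 * Poly Q1.2)); last first.
      by rewrite /= !Poly_pmulX; ring.
    by rewrite mulf_neq0 // polyXsubC_eq0.
  - move=> u; rewrite wb_eval_mulX mem_rcons inE => /orP[/eqP->|/van[-> ->]].
      by rewrite c0 subrr mul0r.
    by rewrite mulr0.
set c := wb_eval Q1 _ _ in nzc *; set e := 0 - wb_eval Q2 _ _.
have szM: (size (Poly (wb_mulX t.1 Q1).1 + Poly (wb_mulX t.1 Q1).2 * h)%R <= r.+2)%N.
  rewrite !Poly_pmulX -mulrA -mulrDr.
  exact: leq_trans (size_XsubCM _ _) _.
have szC: (size (Poly (wb_comb c Q2 e Q1).1 + Poly (wb_comb c Q2 e Q1).2 * h)%R
            <= (r + d).+1)%N.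
  rewrite !Poly_pcomb.
  rewrite [X in polyseq X](_ : _ = c *: (Poly Q2.1 + Poly Q2.2 * h) +
     e *: (Poly Q1.1 + Poly Q1.2 * h)); last by rewrite -!mul_polyC; ring.
  apply: leq_trans (size_polyD _ _) _; rewrite geq_max.
  by rewrite !(leq_trans (size_scale_leq _ _)) //; lia.
have det': Poly (wb_mulX t.1 Q1).1 * Poly (wb_comb c Q2 e Q1).2
         - Poly (wb_comb c Q2 e Q1).1 * Poly (wb_mulX t.1 Q1).2 != 0.
  rewrite /= !Poly_pmulX !Poly_pcomb -!mul_polyC.
  rewrite [X in X != _](_ : _ = c%:P * ('X - t.1%:P) *
      (Poly Q1.1 * Poly Q2.2 - Poly Q2.1 * Poly Q1.2)); last by ring.
  by rewrite !mulf_neq0 ?polyXsubC_eq0 ?polyC_eq0.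
have van': {in rcons p t, forall u, wb_eval (wb_mulX t.1 Q1) u.1 u.2.1 = 0 /\
    wb_eval (wb_comb c Q2 e Q1) u.1 u.2.1 = 0}.
  move=> u; rewrite wb_eval_mulX wb_eval_comb mem_rcons inE.
  case/orP=> [/eqP->|/van[-> ->]]; last by rewrite !mulr0 addr0.
  by rewrite subrr mul0r -/c /e; split=> //; ring.
case: d => [|d] in def_r sz2 szC *.
  rewrite addn0 in szC; exists r; split=> //.
  - by rewrite size_rcons; lia.
  - by rewrite addn1.
  - by rewrite -oppr_eq0 opprB.
  - by move=> u /van'[].
exists r.+1; split=> //; last by rewrite addSnnS.
by rewrite size_rcons; lia.
Qed.

Definition err h : pred point := fun t => t.2.1 != h.[t.1].

(** More than r points of p agree with h, and they are roots of A + B h, which therefore vanishes.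
    Then B is nonzero, since B = 0 would give A = 0 and a zero determinant; so h = - A / B, and its
    first j + 1 coefficients are all of it. *)
Lemma wb_cand_correct j h p Q1 Q2 d :
    wb_inv j h p (Q1, (Q2, d)) -> (size h <= j.+1)%N -> uniq [seq t.1 | t <- p] ->
    (2 * count (err h) p + j < size p)%N ->
  wb_cand j Q1 = mkseq (fun i => h`_i) j.+1.
Proof.
case=> r [def_r sz1 _ det0 van] szh uniq_p lt_p.
have H0: Poly Q1.1 + Poly Q1.2 * h = 0.
  apply/eqP/negPn/negP=> nzH.
  pose rs := [seq t.1 | t <- p & ~~ err h t].
  have: (size rs < size (Poly Q1.1 + Poly Q1.2 * h)%R)%N.
    apply: max_poly_roots => //.
      apply/allP=> _ /mapP[t + ->]; rewrite mem_filter => /andP[/negPn/eqP Dt /van[v1 _]].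
      by rewrite rootE !hornerE -Dt -v1 /wb_eval -!horner_Poly.
    exact: subseq_uniq (map_subseq _ (filter_subseq _ _)) uniq_p.
  have:= count_predC (err h) p; rewrite size_map size_filter.
  rewrite (_ : count (predC _) p = count (fun t => ~~ err h t) p) //; lia.
have nzB: Poly Q1.2 != 0.
  apply: contraNneq det0 => B0; rewrite B0 mul0r addr0 in H0.
  by rewrite H0 B0 mul0r mulr0 subr0.
have:= strip_correct H0 nzB; rewrite /wb_cand; case: (strip _ _) => A B [H1 nzB1].
set hs := mkseq _ _; have <-: size hs = j.+1 by rewrite size_mkseq.
apply: neg_sdiv_correct => //; rewrite -[RHS]H1; congr (_ + _ * _).
apply/polyP=> i; rewrite coef_Poly; case: (ltnP i j.+1) => [lt_i|ge_i].
  by rewrite nth_mkseq.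
by rewrite !nth_default ?size_mkseq // (leq_trans szh).
Qed.

Lemma wb_loop_cons col j e st t rest st' g v :
    wb_step st t.1 t.2.1 = st' -> wb_cand j st'.1 = g ->
    dist_on col (horner_rec g) / e%:R = v ->
  wb_loop col j e st (t :: rest)
    = if 1 <= v then wb_loop col j e st' rest else (last 0 g, v).
Proof. by move=> <- <- <-. Qed.

Lemma wb_loop_sound col j e st rest :
  wb_loop col j e st rest = (0, 1) \/
  exists g, [/\ size g = j.+1, dist_on col (horner_rec g) / e%:R < 1
    & wb_loop col j e st rest = (last 0 g, dist_on col (horner_rec g) / e%:R)].
Proof.
elim: rest st => [|t rest IHrest] st; first by left.
rewrite (wb_loop_cons _ erefl erefl erefl).
case: leP => // lt1; right; exists (wb_cand j (wb_step st t.1 t.2.1).1).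
by rewrite {1}/wb_cand size_neg_sdiv.
Qed.

Lemma horner_rec_mkseq h j a :
  (size h <= j.+1)%N -> horner_rec (mkseq (fun i => h`_i) j.+1) a = h.[a].
Proof.
move=> szh; rewrite -horner_Poly; congr _.[a]; apply/polyP=> i; rewrite coef_Poly.
case: (ltnP i j.+1) => [lt_i|ge_i]; first by rewrite nth_mkseq.
by rewrite !nth_default ?size_mkseq // (leq_trans szh).
Qed.

(** On the prefix of length q the candidate is h, which passes the test. An earlier candidate may be
    accepted instead; the conclusion only says that some candidate is. *)
Lemma wb_loop_complete col j e h p rest st :
    wb_inv j h p st -> (size h <= j.+1)%N -> uniq [seq t.1 | t <- p ++ rest] ->
    dist_on col (fun a => h.[a]) / e%:R < 1 ->
    (exists q, [/\ (size p < q)%N, (q <= size (p ++ rest))%N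
      & (2 * count (err h) (take q (p ++ rest)) + j < q)%N]) ->
  (wb_loop col j e st rest).2 < 1.
Proof.
elim: rest p st => [|t rest IHrest] p st inv szh uniq_p lt1 [q [lt_pq le_q lt_q]].
  by rewrite cats0 in le_q lt_q; lia.
have := wb_inv_step t inv; case Est': (wb_step _ _ _) => [Q1 [Q2 d]] inv'.
rewrite (wb_loop_cons _ Est' erefl erefl) /fst.
rewrite -cat_rcons in uniq_p le_q lt_q *; have [eq_q|ne_q] := eqVneq q (size p).+1.
  rewrite (wb_cand_correct inv') //.
  - set v := dist_on _ _ / _; have ->: v = dist_on col (fun a => h.[a]) / e%:R.
      by congr (_ / _); apply: eq_bigr => u _; rewrite horner_rec_mkseq.
    by rewrite leNgt lt1.
  - by move: uniq_p; rewrite map_cat cat_uniq => /andP[].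
  - by move: lt_q; rewrite eq_q -(size_rcons p t) take_size_cat // size_rcons.
case: ifP => [_ | /negbT]; last by rewrite -ltNge.
 apply: (IHrest _ _ inv') => //; exists q; split=> //.
by rewrite size_rcons; lia.
Qed.

(** * Distance of polynomials on a column and reliability of the decoded symbol *)

Definition valid_column col :=
  uniq [seq t.1 | t <- col] && all (fun t => 0 <= t.2.2 <= 1) col.

(** Of two distinct symbols at most one is the received one, so the gaps add up to u + (2 - u) or to
    2 (2 - u). *)
Lemma gap_triangle (w : F * R) y y' :
  0 <= w.2 <= 1 -> 2 * (y != y')%:R <= gap w y + gap w y'.
Proof.
by rewrite /gap => w01; do 3![case: eqP => ? /=]; by [lra | congruence].
Qed.

Lemma gap_ge0 (w : F * R) y : 0 <= w.2 <= 1 -> 0 <= gap w y.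
Proof. by rewrite /gap; case: eqP => _; lra. Qed.

Lemma poly_distance j col (h h' : {poly F}) :
    valid_column col -> (size h <= j.+1)%N -> (size h' <= j.+1)%N -> h != h' ->
  2 * ((size col)%:R - j%:R) <=
    dist_on col (fun a => h.[a]) + dist_on col (fun a => h'.[a]).
Proof.
case/andP=> uniq_c /allP wt_c szh szh' ne_h.
rewrite -big_split /=; apply: le_trans (_ : \sum_(t <- col) 2 * (h.[t.1] != h'.[t.1])%:R <= _).
  rewrite -mulr_sumr ler_pM2l // -natr_sum lerBlDr -natrD ler_nat.
  rewrite (eq_bigr (fun t : point => if h.[t.1] != h'.[t.1] then 1 else 0)%N);
    last by move=> t _; case: eqP.
  rewrite -big_mkcond /= sum1_count.
  have := count_predC (fun t : point => h.[t.1] != h'.[t.1]) col.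
  suff: (count (predC (fun t : point => h.[t.1] != h'.[t.1])) col <= j)%N by lia.
  rewrite -size_filter -(size_map fst) -ltnS.
  apply: leq_trans (_ : size (h - h')%R <= _)%N; last first.
    by rewrite (leq_trans (size_polyD _ _)) // size_polyN geq_max szh.
  apply: max_poly_roots; first by rewrite subr_eq0.
    apply/allP=> _ /mapP[t + ->]; rewrite mem_filter => /andP[/negPn/eqP eq_t _].
    by rewrite rootE !hornerE eq_t subrr.
  exact: subseq_uniq (map_subseq _ (filter_subseq _ _)) uniq_c.
rewrite big_seq [leRHS]big_seq; apply: ler_sum => t /wt_c; exact: gap_triangle.
Qed.

(** If every prefix length q of the sorted column satisfied q <= 2 errors + j, then
    [sorted_weight_sum_ge] with lo = 0 and d = size col - j would bound the distance of h below by
    size col - j. *)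
Lemma udecode_complete j col h :
    valid_column col -> (j < size col)%N -> (size h <= j.+1)%N ->
    dist_on col (fun a => h.[a]) < (size col - j)%:R ->
  (udecode j (size col - j) col).2 < 1.
Proof.
move=> /andP[uniq_c wt_c] lt_j szh lt_d.
have perm_s := perm_insertion_sort col; set srt := insertion_sort col in perm_s.
have k_gt0: 0 < (size col - j)%:R :> R by rewrite ltr0n; lia.
apply: (@wb_loop_complete _ _ _ h [::]) => //; first exact: wb_inv_init.
- by rewrite cat0s (perm_uniq (perm_map _ perm_s)).
- by rewrite ltr_pdivrMr // mul1r.
rewrite cat0s -/srt.
have [/hasP[q] | /hasPn nq] := boolP (has (fun q : nat => 2 * count (err h) (take q srt) + j < q)%N
   (iota 0 (size srt).+1)).
  by rewrite mem_iota => /andP[_ le_q] lt_q; exists q; split=> //=; lia.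
have := @sorted_weight_sum_ge (err h) srt 0 (size col - j)%:R.
rewrite mul0r add0r subr0 mul1r (perm_all _ perm_s) lexx ler01.
move/(_ (sorted_insertion_sort _) wt_c isT)/(_ _)/wrap; case=> [q le_q|].
  have /nq : q \in iota 0 (size srt).+1 by rewrite mem_iota; lia.
  by rewrite (perm_size perm_s) -leqNgt (natrB _ (ltnW lt_j)) -(ler_nat R) natrD natrM; lra.
rewrite (perm_big _ perm_s) /= leNgt => /negP[]; rewrite (le_lt_trans _ lt_d) //.
rewrite le_eqVlt; apply/orP; left; apply/eqP/eq_bigr=> t _.
by rewrite /gap /err; case: eqP.
Qed.

(* If the decoded polynomial is not h, its distance to the column and that of h
   add up to at least 2 (size col - j). *)
Lemma udecode_correct j col h :
    valid_column col -> (j < size col)%N -> (size h <= j.+1)%N ->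
  gap (udecode j (size col - j) col) h`_j
    <= dist_on col (fun a => h.[a]) / (size col - j)%:R
  /\ 0 <= (udecode j (size col - j) col).2 <= 1.
Proof.
move=> col_ok lt_j szh; have /andP[_ /allP wt_c] := col_ok.
set e := (size col - j)%N; have e_gt0: 0 < e%:R :> R by rewrite ltr0n /e; lia.
have d_ge0 f: 0 <= dist_on col f / e%:R.
  rewrite divr_ge0 ?ler0n // /dist_on big_seq sumr_ge0 // => t /wt_c; exact: gap_ge0.
have complete := udecode_complete col_ok lt_j szh; rewrite -/e in complete.
have [|[g [szg lt_g]]] := wb_loop_sound col j e (wb_init j) (insertion_sort col);
  rewrite -/(udecode j e col) => Eud; rewrite Eud /= in complete *.
  split; last by rewrite ler01 lexx.
  (* For an erasure both values of the gap are 1, and by completeness h is then at distance at least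
     e from the column. *)
  rewrite /gap /= [_ - _](_ : _ = 1) ?if_same; last by ring.
  by rewrite ler_pdivlMr // mul1r leNgt; apply/negP=> /complete; rewrite ltxx.
rewrite d_ge0 (ltW lt_g); split=> //.
have Dg: dist_on col (horner_rec g) = dist_on col (fun a => (Poly g).[a]).
  by apply: eq_bigr => t _; rewrite horner_Poly.
have g_j: last 0 g = (Poly g)`_j by rewrite coef_Poly -nth_last szg.
rewrite g_j Dg in lt_g *; have [<- | ne_h] := eqVneq (Poly g) h.
  by rewrite /gap eqxx.
have szg': (size (Poly g) <= j.+1)%N by rewrite -szg size_Poly.
(* Let v and v' be the distances of g and h divided by e, so that v + v' >= 2 and v < 1. The gap is
   2 - v if the coefficients at j differ. If they happen to coincide it is v, and v < 1 < v'. *)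
have := poly_distance col_ok szg' szh ne_h.
rewrite -(natrB _ (ltnW lt_j)) -/e -(ler_pM2r (_ : 0 < e%:R^-1)) ?invr_gt0 //.
rewrite -mulrA divff ?gt_eqF // mulrDl /gap /=; case: eqP => _; lra.
Qed.

End Univariate.

(** * Multivariate decoding *)

Section Multivariate.
Variables (F : fieldType) (R : realFieldType).
Implicit Types (S : seq (seq F)) (s x : seq F) (D : seq (seq nat)) (b : seq nat).
Implicit Types (ts acc : seq (seq nat * F)) (w : seq F -> F * R) (c : seq nat -> F).
Implicit Types (rho : R) (j e n : nat) (a : F).

Fixpoint mono_eval b x : F :=
  match b, x with
  | i :: b', a :: x' => a ^+ i * mono_eval b' x'
  | _, _ => 1
  end.

Definition terms_eval ts x : F := \sum_(t <- ts) t.2 * mono_eval t.1 x.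

Definition comb D c x : F := \sum_(b <- D) c b * mono_eval b x.

(* The first coordinate varies fastest: this is the order of [points] on the
   reversed sequence of sets, up to reversal of each point. *)
Fixpoint grid S : seq (seq F) :=
  if S is s :: S' then [seq a :: x | x <- grid S', a <- s] else [:: [::]].

Definition dist_grid S w (g : seq F -> F) : R :=
  \sum_(x <- grid S) gap (w x) (g x).

Definition slice j D := [seq behead b | b <- D & ohead b == Some j].

Definition prefix_terms j ts acc := [seq (j :: t.1, t.2) | t <- ts] ++ acc.

Definition sub_terms j ts w y : F * R :=
  if y is a :: x then ((w y).1 - a ^+ j * terms_eval ts x, (w y).2) else w y.

Definition column s w x := [seq (a, w (a :: x)) | a <- s].

(** The sum n + e stays equal to the size of s, so e.+1 is size s - j. The radius is carried as a
    counter because numbers are unary in the program. *)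
Fixpoint decode_loop rec s D n e w acc : seq (seq nat * F) :=
  if n is j.+1 then
    let ts := rec (slice j D) (fun x => udecode j e.+1 (column s w x)) in
    decode_loop rec s D j e.+1 (sub_terms j ts w) (prefix_terms j ts acc)
  else acc.

(** Emptiness of D is tested before S is inspected, so an empty slice starts no further recursion.
    When no coordinate is left, the single received symbol is the constant codeword. *)
Fixpoint decode S D w : seq (seq nat * F) :=
  if D is [::] then [::] else
  if S is s :: S' then decode_loop (decode S') s D (size s) 0 w [::]
  else [:: ([::], (w [::]).1)].

Lemma mem_slice j D b : (b \in slice j D) = (j :: b \in D).
Proof.
apply/mapP/idP => [[[|i b'] /=]|Db]; first by rewrite mem_filter.
  by rewrite mem_filter => /andP[/eqP[->] Db ->].
by exists (j :: b); rewrite ?mem_filter ?eqxx.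
Qed.

Lemma slice_uniq j D : uniq D -> uniq (slice j D).
Proof.
move=> uniqD; rewrite map_inj_in_uniq ?filter_uniq // => [[|i b] [|i' b']] //=.
all: rewrite !mem_filter => /andP[] //= /eqP[->] _ /andP[] //= /eqP[->] _ -> //.
Qed.

Lemma size_slice j D : (size (slice j D) <= size D)%N.
Proof. by rewrite size_map size_filter count_size. Qed.

Lemma sum_size_slice n D :
  (\sum_(j < n) size (slice j D) <= size D)%N.
Proof.
rewrite (eq_bigr (fun j : 'I_n => count (fun b => ohead b == Some (j : nat)) D));
  last by move=> j _; rewrite size_map size_filter.
elim: D => [|b D IHD] /=; first by rewrite big1.
rewrite big_split /= -add1n leq_add //; case: b => [|i b] /=; first by rewrite big1.
have [lt_in|ge_in] := ltnP i n; last first.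
  by rewrite big1 // => j _; case: eqP => // -[Ei]; have:= ltn_ord j; lia.
rewrite (bigD1 (Ordinal lt_in)) //= eqxx big1 // => j ne_j.
by case: eqP => // -[Ei]; case/eqP: ne_j; apply: val_inj.
Qed.

Lemma terms_eval_cat ts acc x :
  terms_eval (ts ++ acc) x = terms_eval ts x + terms_eval acc x.
Proof. exact: big_cat. Qed.

Lemma terms_eval_prefix j ts acc a x :
  terms_eval (prefix_terms j ts acc) (a :: x)
    = a ^+ j * terms_eval ts x + terms_eval acc (a :: x).
Proof.
rewrite terms_eval_cat; congr (_ + _); rewrite /terms_eval big_map mulr_sumr.
by apply: eq_bigr => t _; rewrite mulrCA.
Qed.

Lemma decode_supp S D w :
    {in D, forall b, size b = size S} ->
  {in decode S D w, forall t, t.1 \in D}.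
Proof.
elim: S D w => [|s S IHS] D w szD.
  case: D szD => //= b D szD t; rewrite inE => /eqP->.
  by have /size0nil<- := szD _ (mem_head _ _); rewrite mem_head.
have loop_supp n e w' acc : {in acc, forall t, t.1 \in D} ->
    {in decode_loop (decode S) s D n e w' acc, forall t, t.1 \in D}.
  elim: n e w' acc => //= j IHj e w' acc acc_supp; apply: IHj => t.
  rewrite mem_cat => /orP[/mapP[t' ts_t' ->] | /acc_supp //] /=.
  rewrite -mem_slice; apply: IHS ts_t' => b; rewrite mem_slice => /szD[] //.
by case: D szD loop_supp => // b D _; apply.
Qed.

Lemma size_decode S D w : (size (decode S D w) <= size D)%N.
Proof.
elim: S D w => [|s S IHS] D w; first by case: D.
have loop_size n e w' acc : (size (decode_loop (decode S) s D n e w' acc)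
    <= \sum_(l < n) size (slice l D) + size acc)%N.
  elim: n e w' acc => [|j IHj] e w' acc /=; first by rewrite big_ord0.
  apply: leq_trans (IHj _ _ _) _; rewrite big_ord_recr /= size_cat size_map addnA.
  by rewrite leq_add2r leq_add2l.
case: D loop_size => // b D loop_size; apply: leq_trans (loop_size _ _ _ _) _.
by rewrite addn0 sum_size_slice.
Qed.

Lemma comb_slices n D c a x :
    {in D, forall b, exists2 i, ohead b = Some i & (i < n)%N} ->
  comb D c (a :: x)
    = \sum_(l < n) a ^+ l * comb (slice l D) (fun b => c ((l : nat) :: b)) x.
Proof.
move=> head_D; rewrite /comb big_seq.
transitivity (\sum_(b <- D | b \in D) \sum_(l < n | ohead b == Some (l : nat))
    a ^+ l * (c ((l : nat) :: behead b) * mono_eval (behead b) x)).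
  apply: eq_bigr => b /head_D[i]; case: b => //= _ b [->] lt_in.
  rewrite (big_pred1 (Ordinal lt_in)) /=; last by move=> l; apply/eqP/eqP => [[]|->] // E; apply: val_inj.
  by rewrite mulrCA.
rewrite -big_seq (exchange_big_dep predT) //=; apply: eq_bigr => l _.
by rewrite big_map big_filter mulr_sumr.
Qed.

(** * Minimum weight of a downset code and of its slices *)

Definition box S b := all2 (fun i (s : seq F) => (i < size s)%N) b S.

Definition downset D := forall b b', b' \in D -> all2 leq b b' -> b \in D.

Lemma box_size S b : box S b -> size b = size S.
Proof. by rewrite /box all2E => /andP[/eqP]. Qed.

(** A lower bound, not the minimum itself, and a number in R, because it is divided by size s - j in
    passing to a slice. *)
Definition min_weight S D rho :=
  forall c, has (fun x => comb D c x != 0) (grid S) ->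
  rho <= (count (fun x => comb D c x != 0) (grid S))%:R.

Lemma downset_slice j D : downset D -> downset (slice j D).
Proof.
move=> downD b b'; rewrite !mem_slice => Db' le_b.
by apply: downD Db' _; rewrite /= leqnn.
Qed.

Lemma box_slice s S D j : all (box (s :: S)) D -> all (box S) (slice j D).
Proof.
move/allP=> boxD; apply/allP=> b; rewrite mem_slice => /boxD /=.
by case/andP.
Qed.

(* Multiply by the polynomial that vanishes exactly on the first j elements of s. *)
Lemma min_weight_slice s S D rho j :
    uniq s -> uniq D -> all (box (s :: S)) D -> downset D -> (j < size s)%N ->
  min_weight (s :: S) D rho ->
  min_weight S (slice j D) (rho / (size s - j)%:R).
Proof.
move=> uniq_s uniqD boxD downD lt_j minD c /hasP[x0 gx0 nz0].
have k_gt0: 0 < (size s - j)%:R :> R by rewrite ltr0n; lia.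
pose q : {poly F} := \prod_(z <- take j s) ('X - z%:P).
have szq: size q = j.+1 by rewrite size_prod_XsubC size_take lt_j.
have q0 a : (q.[a] == 0) = (a \in take j s) by rewrite -/(root q a) root_prod_XsubC.
(* The coefficients of the product of q and the codeword on the slice. For l <= j the slice at l
   contains the slice at j because D is a downset, so the product has its exponents in D; the guard
   puts zeros on the rest of the larger slice. *)
pose c' b := if behead b \in slice j D then q`_(head 0%N b) * c (behead b) else 0.
have Dc' a x : comb D c' (a :: x) = q.[a] * comb (slice j D) c x.
  rewrite (@comb_slices (size s)); last first.
    by move=> [|i b] /(allP boxD) //= /andP[lt_i _]; exists i.
  rewrite -[q in RHS](@coefK _ q) horner_poly szq (big_ord_widen (size s) (fun l => q`_l * a ^+ l)) //.
  rewrite mulr_suml [RHS]big_mkcond /=; apply: eq_bigr => l _.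
  case: ltnP => [le_l|gt_l]; last first.
    rewrite [comb _ _ _]big1 ?mulr0 // => b _; rewrite /c' /=.
    by rewrite nth_default ?szq // mul0r if_same mul0r.
  rewrite [RHS]mulrAC [RHS]mulrC; congr (_ * _); rewrite /comb mulr_sumr /c' /=.
  transitivity (\sum_(b <- slice l D | b \in slice j D) q`_l * (c b * mono_eval b x)).
    rewrite [RHS]big_mkcond; apply: eq_bigr => b _.
    by case: ifP => _; rewrite ?mul0r // mulrA.
  rewrite -[LHS]big_filter; apply: perm_big.
  apply: uniq_perm => [||b]; rewrite ?filter_uniq ?slice_uniq // mem_filter.
  rewrite !mem_slice; case Db: (_ \in D) => //=; apply: downD Db _ => /=.
  by rewrite -ltnS le_l /=; elim: b => //= i b ->; rewrite leqnn.
have nz_q: has (fun a => q.[a] != 0) s.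
  apply/hasP; exists (nth 0 s j); rewrite ?mem_nth // q0.
  by rewrite in_take ?mem_nth // index_uniq // ltnn.
have count_q: count (fun a => q.[a] != 0) s = (size s - j)%N.
  rewrite (eq_count (a2 := fun a => a \notin take j s)) => [|a]; last by rewrite q0.
  rewrite -{2}(cat_take_drop j s) count_cat.
  rewrite (eq_in_count (a2 := pred0)) ?count_pred0; last by move=> a /= ->.
  rewrite (eq_in_count (a2 := predT)) ?count_predT ?size_drop //= => a drop_a.
  move: uniq_s; rewrite -{1}(cat_take_drop j s) cat_uniq => /and3P[_ /hasPn nd _].
  by rewrite (nd _ drop_a).
rewrite ler_pdivrMr // -natrM.
have := minD c'; set cD := count _ (grid (s :: S)).
have -> : cD = (count (fun x => comb (slice j D) c x != 0%R) (grid S) * (size s - j))%N.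
  rewrite /cD /= -count_q; elim: (grid S) => //= x X IHX.
  rewrite count_cat IHX mulnDl; congr (_ + _)%N; rewrite count_map.
  rewrite (eq_count (a2 := fun a => (q.[a] != 0) && (comb (slice j D) c x != 0))).
    case: (comb _ _ _ =P 0) => _; rewrite ?mul1n ?mul0n.
      by rewrite (eq_count (a2 := pred0)) ?count_pred0 // => a; rewrite andbF.
    by apply: eq_count => a; rewrite andbT.
  by move=> a /=; rewrite Dc' mulf_eq0 negb_or.
apply; have /hasP[a sa nza] := nz_q; apply/hasP; exists (a :: x0).
  by apply/allpairsP; exists (x0, a).
by rewrite Dc' mulf_neq0.
Qed.

Lemma decode_correct S D w rho c :
    all uniq S -> uniq D -> all (box S) D -> downset D ->
    {in grid S, forall x, 0 <= (w x).2 <= 1} ->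
    min_weight S D rho -> dist_grid S w (comb D c) < rho ->
  forall x, size x = size S -> terms_eval (decode S D w) x = comb D c x.
Proof.
elim: S D w rho c => [|s S IHS] D w rho c uniqS uniqD boxD downD wt minD ltD.
  have [D0 | D1]: D = [::] \/ D = [:: [::]].
  - case: D uniqD boxD {downD minD ltD} => [|b D]; first by left.
    move=> uniqD boxD; right; have D0 b' : b' \in b :: D -> b' = [::].
      by move/(allP boxD)/box_size/size0nil.
    rewrite (D0 b (mem_head _ _)); case: D {boxD} uniqD D0 => //= b' D /andP[/negP nb _] D0.
    have eqb: b = b'.
      by apply: etrans (D0 b _) (esym (D0 b' _)); rewrite !inE eqxx ?orbT.
    by case: nb; rewrite eqb mem_head.
  - by move=> x _; rewrite D0 /terms_eval /comb !big_nil.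
  rewrite D1 in minD ltD *.
  move=> [|//] _; rewrite /terms_eval /comb /= !big_seq1 /= !mulr1.
  (* A wrong symbol would have gap 2 - u >= 1, while the constant codeword 1 shows that rho <= 1. *)
  apply/eqP/negPn/negP=> ne; move: ltD; rewrite ltNge => /negP[].
  apply: le_trans (minD (fun=> 1) _) _.
    by rewrite /= /comb big_seq1 /= mulr1 oner_eq0.
  rewrite /dist_grid /= big_seq1 /comb !big_seq1 /= !mulr1 oner_eq0 /=.
  by rewrite /gap (negPf ne); have:= wt [::] (mem_head _ _); lra.
case/andP: uniqS => uniq_s uniqS.
have head_D: {in D, forall b, exists2 i, ohead b = Some i & (i < size s)%N}.
  by move=> [|i b] /(allP boxD) //= /andP[lt_i _]; exists i.
pose P l x := comb (slice l D) (fun b => c (l :: b)) x.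
have combE a x : comb D c (a :: x) = \sum_(l < size s) a ^+ l * P l x.
  exact: comb_slices.
(* The invariant keeps the same rho throughout the loop: subtracting a^j P_j from the word and from
   the sum of the P_l changes no gap. Only the recursive call for P_j uses rho / (size s - j). *)
have loopE n e w' acc : (n + e)%N = size s ->
    {in grid (s :: S), forall y, 0 <= (w' y).2 <= 1} ->
    \sum_(x <- grid S) \sum_(a <- s)
      gap (w' (a :: x)) (\sum_(l < n) a ^+ l * P l x) < rho ->
    forall a x, size x = size S ->
    terms_eval (decode_loop (decode S) s D n e w' acc) (a :: x)
      = \sum_(l < n) a ^+ l * P l x + terms_eval acc (a :: x).
  elim: n e w' acc => [|j IHj] e w' acc eq_k wt' lt_rho a x szx /=.
    by rewrite big_ord0 add0r.
  have lt_j : (j < size s)%N by lia.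
  have De: e.+1 = (size s - j)%N by lia.
  set w1 := fun x => udecode _ _ _; set ts := decode _ _ _.
  have col_ok y : y \in grid S -> valid_column (column s w' y).
    move=> gy; rewrite /valid_column -map_comp map_id uniq_s /=.
    apply/allP=> _ /mapP[z sz ->]; apply: wt'.
    by apply/allpairsP; exists (y, z).
  have szcol y : size (column s w' y) = size s by rewrite size_map.
  pose h y := \poly_(l < j.+1) P l y.
  have hE y z : (h y).[z] = \sum_(l < j.+1) z ^+ l * P l y.
    by rewrite horner_poly; apply: eq_bigr => l _; rewrite mulrC.
  have w1_ok y : y \in grid S -> gap (w1 y) (P j y) <=
      (\sum_(z <- s) gap (w' (z :: y)) (\sum_(l < j.+1) z ^+ l * P l y)) / e.+1%:R
      /\ 0 <= (w1 y).2 <= 1.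
    move=> gy; have := @udecode_correct _ _ j _ (h y) (col_ok y gy).
    rewrite szcol -De => /(_ lt_j (size_poly _ _)).
    rewrite coef_poly ltnSn /dist_on big_map /=.
    by under eq_bigr do rewrite hE.
  have e_gt0: 0 < e.+1%:R^-1 :> R by rewrite invr_gt0 ltr0n.
  have tsE y : size y = size S -> terms_eval ts y = P j y.
    apply: (IHS _ _ (rho / e.+1%:R)) => //.
    - exact: slice_uniq.
    - exact: box_slice boxD.
    - exact: downset_slice.
    - by move=> z /w1_ok[].
    - by rewrite De; apply: min_weight_slice.
    apply: le_lt_trans (_ : (\sum_(y <- grid S) \sum_(z <- s)
      gap (w' (z :: y)) (\sum_(l < j.+1) z ^+ l * P l y)) / e.+1%:R < _); last first.
      by rewrite ltr_pM2r.
    rewrite mulr_suml /dist_grid big_seq [leRHS]big_seq.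
    by apply: ler_sum => z /w1_ok[].
  have sz_grid y : y \in grid S -> size y = size S.
    elim: (S) y => [|s' S' IH] y /=; first by rewrite inE => /eqP->.
    by case/allpairsP=> -[y' z] /= [/IH <- _ ->].
  rewrite IHj //; first by rewrite terms_eval_prefix tsE // big_ord_recr /= addrA.
  - by lia.
  - by move=> _ /allpairsP[[y z] /= [gy sz ->]]; apply: wt'; apply/allpairsP; exists (y, z).
  apply: le_lt_trans lt_rho; rewrite le_eqVlt; apply/orP; left; apply/eqP.
  rewrite big_seq [RHS]big_seq; apply: eq_bigr => y gy; apply: eq_bigr => z _.
  rewrite big_ord_recr /= tsE ?sz_grid // /gap /=; congr (if _ then _ else _).
  by rewrite subr_eq.
case=> [//|a x] [szx]; rewrite combE.
have ->: decode (s :: S) D w = decode_loop (decode S) s D (size s) 0 w [::].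
  (* The shortcut for empty D agrees with the loop, all of whose slices are then empty. *)
  have nil_loop n e w' : decode_loop (decode S) s [::] n e w' [::] = [::].
    by elim: n e w' => //= j IHj e w'; case: (S) IHj => [|s' S'] ->.
  by case: (D); rewrite ?nil_loop.
rewrite loopE ?addn0 //; first by rewrite /terms_eval big_nil addr0.
move: ltD; rewrite /dist_grid /= big_allpairs_dep /=.
by under [X in X < _ -> _]eq_bigr do under eq_bigr do rewrite combE.
Qed.

End Multivariate.

(** * The program *)

(* On a list, [Snd] also computes the tail, with tail nil = nil, and on a unary
   number the predecessor. *)
Definition V := EVar.
Definition Fst e := ECase e ENil (V 0).
Definition Snd e := ECase e ENil (V 1).
Definition Hd0 e := ECase e (EFConst false) (V 0).
Definition Succ e := EPair ENil e.
Definition Zero := EFConst false.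

(* The argument of the function f_x is a tuple laid out as in lemma calls_x below. *)
Definition f_main := 0%N.
Definition f_rev := 1%N.
Definition f_rev_all := 2%N.
Definition f_rev_terms := 3%N.
Definition f_decode := 4%N.
Definition f_loop := 5%N.
Definition f_length := 6%N.
Definition f_cut := 7%N.
Definition f_columns := 8%N.
Definition f_snd_app := 9%N.
Definition f_flatten := 10%N.
Definition f_eqn := 11%N.
Definition f_slice := 12%N.
Definition f_prefix := 13%N.
Definition f_pow := 14%N.
Definition f_sub_column := 15%N.
Definition f_sub_columns := 16%N.
Definition f_udecode_all := 17%N.
Definition f_udecode := 18%N.
Definition f_insert := 19%N.
Definition f_sort := 20%N.
Definition f_wb_loop := 21%N.
Definition f_wb_step := 22%N.
Definition f_wb_eval := 23%N.
Definition f_pmulX := 24%N.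
Definition f_pcomb := 25%N.
Definition f_horner := 26%N.
Definition f_padd := 27%N.
Definition f_pscale := 28%N.
Definition f_strip := 29%N.
Definition f_sdiv := 30%N.
Definition f_dist := 31%N.
Definition f_last := 32%N.

(** Only the sets and the exponents are reversed. The table of the word is already in the order in
    which [grid] lists the points of the reversed sets. *)
Definition b_main :=
  ECall f_rev_terms (Fst (ECall f_decode
    (EPair (ECall f_rev (EPair (Fst (V 0)) ENil))
    (EPair (ECall f_rev_all (Fst (Snd (V 0)))) (Snd (Snd (V 0))))))).

Definition b_rev :=
  ECase (Fst (V 0)) (Snd (V 0))
    (ECall f_rev (EPair (V 1) (EPair (V 0) (Snd (V 2))))).

Definition b_rev_all :=
  ECase (V 0) ENil
    (EPair (ECall f_rev (EPair (V 0) ENil)) (ECall f_rev_all (V 1))).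

Definition b_rev_terms :=
  ECase (V 0) ENil
    (EPair (EPair (ECall f_rev (EPair (Fst (V 0)) ENil)) (Snd (V 0)))
           (ECall f_rev_terms (V 1))).

(** Besides the terms, the table of the word minus the decoded codeword is returned. The caller
    obtains the values of the codeword as the difference of two tables, so terms are never evaluated
    at points and the points themselves are never built. *)
Definition b_decode :=
  ECase (Fst (Snd (V 0))) (EPair ENil (Snd (Snd (V 0))))
    (ECase (Fst (V 2))
      (EPair (EPair (EPair ENil (Fst (Fst (Snd (Snd (V 2)))))) ENil)
             (EPair (EPair Zero (Snd (Fst (Snd (Snd (V 2)))))) ENil))
      (ELet (ECall f_loop (EPair (V 1) (EPair (Fst (Snd (V 4)))
               (EPair (ECall f_columns (EPair (V 0) (Snd (Snd (V 4)))))
               (EPair (ECall f_length (V 0)) (EPair ENil ENil))))))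
        (EPair (Fst (V 0)) (ECall f_flatten (Snd (V 0)))))).

Definition b_loop :=
  let S := Fst (V 4) in
  let D := Fst (Snd (V 4)) in
  let cols := Fst (Snd (Snd (V 4))) in
  let e := Fst (Snd (Snd (Snd (Snd (V 4))))) in
  let acc := Snd (Snd (Snd (Snd (Snd (V 4))))) in
  ECase (Fst (Snd (Snd (Snd (V 0)))))
    (EPair (Snd (Snd (Snd (Snd (Snd (V 0)))))) (Fst (Snd (Snd (V 0)))))
    (ELet (ECall f_udecode_all (EPair (Fst (Snd (Snd (Snd (V 2)))))
            (EPair (Succ (Fst (Snd (Snd (Snd (Snd (V 2)))))))
                   (Fst (Snd (Snd (V 2)))))))
    (ELet (ECall f_decode (EPair (Fst (V 3))
            (EPair (ECall f_slice (EPair (V 2) (Fst (Snd (V 3))))) (V 0))))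
    (ECall f_loop (EPair S (EPair D
      (EPair (ECall f_sub_columns
                (EPair (V 3) (EPair cols (EPair (V 1) (Snd (V 0))))))
      (EPair (V 3) (EPair (Succ e)
        (ECall f_prefix (EPair (V 3) (EPair (Fst (V 0)) acc))))))))))).

Definition b_length := ECase (V 0) ENil (Succ (ECall f_length (V 1))).

Definition b_cut :=
  ECase (Fst (V 0)) (EPair ENil (Snd (V 0)))
    (ELet (ECall f_cut (EPair (V 1) (Snd (Snd (V 2)))))
      (EPair (EPair (EPair (V 1) (Fst (Snd (V 3)))) (Fst (V 0))) (Snd (V 0)))).

Definition b_columns :=
  ECase (Snd (V 0)) ENil
    (ELet (ECall f_cut (V 2))
      (EPair (Fst (V 0)) (ECall f_columns (EPair (Fst (V 3)) (Snd (V 0)))))).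

Definition b_snd_app :=
  ECase (Fst (V 0)) (Snd (V 0))
    (EPair (Snd (V 0)) (ECall f_snd_app (EPair (V 1) (Snd (V 2))))).

Definition b_flatten :=
  ECase (V 0) ENil
    (ECall f_snd_app (EPair (V 0) (ECall f_flatten (V 1)))).

Definition b_eqn :=
  ECase (Fst (V 0)) (ECase (Snd (V 0)) (Succ ENil) ENil)
    (ECase (Snd (V 2)) ENil (ECall f_eqn (EPair (V 3) (V 1)))).

(** Here and in the later tests false is nil, so the first branch of [ECase] is the one taken when
    the test fails. *)
Definition b_slice :=
  ECase (Snd (V 0)) ENil
    (ECase (V 0) (ECall f_slice (EPair (Fst (V 2)) (V 1)))
      (ECase (ECall f_eqn (EPair (V 0) (Fst (V 4))))
        (ECall f_slice (EPair (Fst (V 4)) (V 3)))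
        (EPair (V 3) (ECall f_slice (EPair (Fst (V 6)) (V 5)))))).

Definition b_prefix :=
  ECase (Fst (Snd (V 0))) (Snd (Snd (V 0)))
    (EPair (EPair (EPair (Fst (V 2)) (Fst (V 0))) (Snd (V 0)))
      (ECall f_prefix (EPair (Fst (V 2)) (EPair (V 1) (Snd (Snd (V 2))))))).

Definition b_pow :=
  ECase (Snd (V 0)) (EFConst true)
    (EFOp FMul (Fst (V 2)) (ECall f_pow (EPair (Fst (V 2)) (V 1)))).

Definition b_sub_column :=
  ECase (Snd (Snd (V 0))) ENil
    (EPair (EPair (Fst (V 0)) (EPair
       (EFOp FSub (Fst (Snd (V 0)))
          (EFOp FMul (ECall f_pow (EPair (Fst (V 0)) (Fst (V 2))))
                     (Fst (Snd (V 2)))))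
       (Snd (Snd (V 0)))))
     (ECall f_sub_column
        (EPair (Fst (V 2)) (EPair (Fst (Snd (V 2))) (V 1))))).

Definition b_sub_columns :=
  let ws := Fst (Snd (Snd (V 2))) in
  let rs := Snd (Snd (Snd (V 2))) in
  ECase (Fst (Snd (V 0))) ENil
    (EPair (ECall f_sub_column (EPair (Fst (V 2))
              (EPair (EFOp FSub (Fst (Fst ws)) (Fst (Fst rs))) (V 0))))
       (ECall f_sub_columns (EPair (Fst (V 2))
          (EPair (V 1) (EPair (Snd ws) (Snd rs)))))).

Definition b_udecode_all :=
  ECase (Snd (Snd (V 0))) ENil
    (EPair (ECall f_udecode (EPair (Fst (V 2)) (EPair (Fst (Snd (V 2))) (V 0))))
       (ECall f_udecode_all
          (EPair (Fst (V 2)) (EPair (Fst (Snd (V 2))) (V 1))))).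

Definition b_udecode :=
  let one := EPair (EFConst true) ENil in
  ECall f_wb_loop (EPair (Snd (Snd (V 0))) (EPair (Fst (V 0))
    (EPair (Fst (Snd (V 0)))
    (EPair (EPair (EPair one ENil) (EPair (EPair ENil one) (Snd (Fst (V 0)))))
           (ECall f_sort (Snd (Snd (V 0)))))))).

Definition b_insert :=
  ECase (Snd (V 0)) (EPair (Fst (V 0)) ENil)
    (ECase (EWLe (Snd (Snd (Fst (V 2)))) (Snd (Snd (V 0))))
       (EPair (V 0) (ECall f_insert (EPair (Fst (V 2)) (V 1))))
       (EPair (Fst (V 4)) (Snd (V 4)))).

Definition b_sort :=
  ECase (V 0) ENil (ECall f_insert (EPair (V 0) (ECall f_sort (V 1)))).

Definition b_wb_loop :=
  let col i := Fst (V i) in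
  let n i := Fst (Snd (V i)) in
  let e i := Fst (Snd (Snd (V i))) in
  let st i := Fst (Snd (Snd (Snd (V i)))) in
  let rest i := Snd (Snd (Snd (Snd (V i)))) in
  ECase (rest 0) (EPair Zero (EWConst true))
    (ELet (ECall f_wb_step (EPair (st 2) (EPair (Fst (V 0)) (Fst (Snd (V 0))))))
    (ELet (ECall f_sdiv (EPair (n 3) (ECall f_strip (Fst (V 0)))))
    (ELet (EWDivn (ECall f_dist (EPair (V 0) (col 4))) (e 4))
    (ECase (EWLe (EWConst true) (V 0))
       (EPair (ECall f_last (V 1)) (V 0))
       (ECall f_wb_loop (EPair (col 7) (EPair (n 7) (EPair (e 7)
          (EPair (V 4) (V 6)))))))))).

Definition b_wb_step :=
  let Q1 i := Fst (Fst (V i)) in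
  let Q2 i := Fst (Snd (Fst (V i))) in
  let d i := Snd (Snd (Fst (V i))) in
  let a i := Fst (Snd (V i)) in
  ELet (ECall f_wb_eval (EPair (Q1 0) (Snd (V 0))))
  (ECase (EFEq (V 0) Zero)
    (ELet (EPair (ECall f_pmulX (EPair (a 1) (Fst (Q1 1))))
                 (ECall f_pmulX (EPair (a 1) (Snd (Q1 1)))))
    (ELet (EFOp FSub Zero (ECall f_wb_eval (EPair (Q2 2) (Snd (V 2)))))
    (ELet (EPair (ECall f_pcomb (EPair (V 2) (EPair (Fst (Q2 3))
                    (EPair (V 0) (Fst (Q1 3))))))
                 (ECall f_pcomb (EPair (V 2) (EPair (Snd (Q2 3))
                    (EPair (V 0) (Snd (Q1 3)))))))
      (ECase (d 4)
         (EPair (V 0) (EPair (V 2) (Succ ENil)))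
         (EPair (V 4) (EPair (V 2) (V 1)))))))
    (EPair (Q1 3) (EPair (EPair (ECall f_pmulX (EPair (a 3) (Fst (Q2 3))))
                                (ECall f_pmulX (EPair (a 3) (Snd (Q2 3)))))
                         (Succ (d 3))))).

Definition b_wb_eval :=
  EFOp FAdd (ECall f_horner (EPair (Fst (Fst (V 0))) (Fst (Snd (V 0)))))
    (EFOp FMul (ECall f_horner (EPair (Snd (Fst (V 0))) (Fst (Snd (V 0)))))
               (Snd (Snd (V 0)))).

Definition b_pmulX :=
  ECall f_padd (EPair (EPair Zero (Snd (V 0)))
    (ECall f_pscale (EPair (EFOp FSub Zero (Fst (V 0))) (Snd (V 0))))).

Definition b_pcomb :=
  ECall f_padd (EPair
    (ECall f_pscale (EPair (Fst (V 0)) (Fst (Snd (V 0)))))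
    (ECall f_pscale (Snd (Snd (V 0))))).

Definition b_horner :=
  ECase (Fst (V 0)) Zero
    (EFOp FAdd (EFOp FMul (ECall f_horner (EPair (V 1) (Snd (V 2))))
                          (Snd (V 2))) (V 0)).

Definition b_padd :=
  ECase (Fst (V 0)) (Snd (V 0))
    (ECase (Snd (V 2)) (Fst (V 2))
      (EPair (EFOp FAdd (V 2) (V 0)) (ECall f_padd (EPair (V 3) (V 1))))).

Definition b_pscale :=
  ECase (Snd (V 0)) ENil
    (EPair (EFOp FMul (Fst (V 2)) (V 0))
           (ECall f_pscale (EPair (Fst (V 2)) (V 1)))).

Definition b_strip :=
  ECase (Snd (V 0)) (V 0)
    (ECase (EFEq (V 0) Zero) (V 2)
       (ECall f_strip (EPair (Snd (Fst (V 4))) (V 3)))).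

Definition b_sdiv :=
  ECase (Fst (V 0)) ENil
    (ELet (EFOp FDiv (EFOp FSub Zero (Hd0 (Fst (Snd (V 2)))))
                     (Hd0 (Snd (Snd (V 2)))))
      (EPair (V 0) (ECall f_sdiv (EPair (V 2) (EPair
         (Snd (ECall f_padd (EPair (Fst (Snd (V 3)))
                 (ECall f_pscale (EPair (V 0) (Snd (Snd (V 3))))))))
         (Snd (Snd (V 3)))))))).

Definition b_dist :=
  ECase (Snd (V 0)) (EWConst false)
    (EWOp WAdd
       (ECase (EFEq (Fst (Snd (V 0)))
                    (ECall f_horner (EPair (Fst (V 2)) (Fst (V 0)))))
          (EWOp WSub (EWOp WAdd (EWConst true) (EWConst true)) (Snd (Snd (V 0))))
          (Snd (Snd (V 2))))
       (ECall f_dist (EPair (Fst (V 2)) (V 1)))).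

Definition b_last :=
  ECase (V 0) Zero (ECase (V 1) (V 0) (ECall f_last (V 3))).

Definition decoder : program :=
  [:: b_main; b_rev; b_rev_all; b_rev_terms; b_decode; b_loop; b_length; b_cut;
      b_columns; b_snd_app; b_flatten; b_eqn; b_slice; b_prefix; b_pow;
      b_sub_column; b_sub_columns; b_udecode_all; b_udecode; b_insert; b_sort;
      b_wb_loop; b_wb_step; b_wb_eval; b_pmulX; b_pcomb; b_horner; b_padd;
      b_pscale; b_strip; b_sdiv; b_dist; b_last].

Section Implementation.
Variables (F : fieldType) (R : realFieldType).
Notation value := (value F R).
Implicit Types (v : value) (env : seq value) (T : nat).

(** [encl] and [encn] restate [enc_seq] and [enc_nat] as fixpoints that reduce on a constructor, as
    symbolic execution requires. *)
Fixpoint encl (X : Type) (f : X -> value) (l : seq X) : value :=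
  if l is x :: l' then VPair (f x) (encl f l') else VNil _ _.

Fixpoint encn n : value := if n is n'.+1 then VPair (VNil _ _) (encn n') else VNil _ _.

Notation encP := (encl (VField _)).
Definition encQ (Q : seq F * seq F) : value := VPair (encP Q.1) (encP Q.2).
Definition encE (w : F * R) : value := VPair (VField _ w.1) (VWeight _ w.2).
Definition encpt (t : F * (F * R)) : value := VPair (VField _ t.1) (encE t.2).
Notation encb := (encl encn).
Definition enct (t : seq nat * F) : value := VPair (encb t.1) (VField _ t.2).
Definition encst (st : (seq F * seq F) * ((seq F * seq F) * nat)) : value :=
  VPair (encQ st.1) (VPair (encQ st.2.1) (encn st.2.2)).

(* Unlike in [eval], T is only an upper bound on the time. *)
Definition ev env e v T := exists2 t, eval decoder env e v t & (t <= T)%N.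

(** Merges the two rules for [ECase] into one; the branch is selected by reduction once the
    constructor of v is visible. *)
Definition evcase env v e1 e2 v' T :=
  match v with
  | VNil => ev env e1 v' T
  | VPair a b => ev (a :: b :: env) e2 v' T
  | _ => False
  end.

Definition calls k v v' T := ev [:: v] (nth ENil decoder k) v' T.

Lemma ev_weak env e v v' T T' : ev env e v T -> v = v' -> (T <= T')%N -> ev env e v' T'.
Proof. by case=> t Et le_t <- le_T; exists t => //; apply: leq_trans le_T. Qed.

Lemma calls_weak k v v' T T' : calls k v v' T -> (T <= T')%N -> calls k v v' T'.
Proof. by move=> C le_T; apply: ev_weak C erefl le_T. Qed.

Lemma ev_var env i v : onth env i = Some v -> ev env (V i) v 1.
Proof. by exists 1%N => //; apply: eval_var. Qed.

Lemma ev_let env e1 e2 v1 v2 T1 T2 :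
  ev env e1 v1 T1 -> ev (v1 :: env) e2 v2 T2 -> ev env (ELet e1 e2) v2 (T1 + T2).+1.
Proof. by case=> t1 E1 le1 [t2 E2 le2]; exists (t1 + t2).+1; [econstructor; eauto | lia]. Qed.

Lemma ev_nil env : ev env ENil (VNil _ _) 1.
Proof. by exists 1%N => //; constructor. Qed.

Lemma ev_pair env e1 e2 v1 v2 T1 T2 :
  ev env e1 v1 T1 -> ev env e2 v2 T2 -> ev env (EPair e1 e2) (VPair v1 v2) (T1 + T2).+1.
Proof. by case=> t1 E1 le1 [t2 E2 le2]; exists (t1 + t2).+1; [econstructor; eauto | lia]. Qed.

Lemma ev_case env e e1 e2 v v' T T' :
  ev env e v T -> evcase env v e1 e2 v' T' -> ev env (ECase e e1 e2) v' (T + T').+1.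
Proof.
case=> t Et le_t; case: v Et => //= [|a b] Et [t' Et' le_t'];
  exists (t + t').+1; try lia; [exact: eval_case_nil Et Et' | exact: eval_case_pair Et Et'].
Qed.

Lemma ev_fst env e a b T : ev env e (VPair a b) T -> ev env (Fst e) a T.+2.
Proof.
by move=> Ee; rewrite -[T.+1]addn1; apply: ev_case Ee _; apply: ev_var.
Qed.

Lemma ev_snd env e a b T : ev env e (VPair a b) T -> ev env (Snd e) b T.+2.
Proof.
by move=> Ee; rewrite -[T.+1]addn1; apply: ev_case Ee _; apply: ev_var.
Qed.

Lemma ev_behead env e (X : Type) (f : X -> value) l T :
  ev env e (encl f l) T -> ev env (Snd e) (encl f (behead l)) T.+2.
Proof.
move=> Ee; rewrite -[T.+1]addn1; apply: ev_case Ee _.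
by case: l => [|x l] /=; [apply: ev_nil | apply: ev_var].
Qed.

Lemma ev_fconst env (b : bool) : ev env (EFConst b) (VField _ b%:R) 1.
Proof. by exists 1%N => //; constructor. Qed.

Lemma ev_zero env : ev env Zero (VField _ 0) 1.
Proof. exact: ev_fconst. Qed.

Lemma ev_head env e p T : ev env e (encP p) T -> ev env (Hd0 e) (VField _ (head 0 p)) T.+2.
Proof.
move=> Ee; rewrite -[T.+1]addn1; apply: ev_case Ee _.
by case: p => [|x p] /=; [apply: ev_zero | apply: ev_var].
Qed.

Lemma ev_call env k e v v' T T' :
  (k < size decoder)%N -> ev env e v T -> calls k v v' T' ->
  ev env (ECall k e) v' (T + T').+1.
Proof.
move=> lt_k [t Et le_t] [t' Et' le_t']; exists (t + t').+1; last lia.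
have := onthTE decoder k; rewrite lt_k; case Eb: (onth _ _) => [b|] // _.
by rewrite (@onth_nth _ ENil _ _ _ Eb) in Et'; apply: eval_call Et Et'.
Qed.

Lemma ev_fop env o e1 e2 x1 x2 T1 T2 :
  ev env e1 (VField _ x1) T1 -> ev env e2 (VField _ x2) T2 ->
  ev env (EFOp o e1 e2) (VField _ (fop_eval o x1 x2)) (T1 + T2).+1.
Proof. by case=> t1 E1 le1 [t2 E2 le2]; exists (t1 + t2).+1; [econstructor; eauto | lia]. Qed.

Lemma ev_feq env e1 e2 x1 x2 T1 T2 :
  ev env e1 (VField _ x1) T1 -> ev env e2 (VField _ x2) T2 ->
  ev env (EFEq e1 e2) (enc_bool _ _ (x1 == x2)) (T1 + T2).+1.
Proof. by case=> t1 E1 le1 [t2 E2 le2]; exists (t1 + t2).+1; [econstructor; eauto | lia]. Qed.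

Lemma ev_wconst env (b : bool) : ev env (EWConst b) (VWeight _ b%:R) 1.
Proof. by exists 1%N => //; constructor. Qed.

Lemma ev_wop env o e1 e2 x1 x2 T1 T2 :
  ev env e1 (VWeight _ x1) T1 -> ev env e2 (VWeight _ x2) T2 ->
  ev env (EWOp o e1 e2) (VWeight _ (wop_eval o x1 x2)) (T1 + T2).+1.
Proof. by case=> t1 E1 le1 [t2 E2 le2]; exists (t1 + t2).+1; [econstructor; eauto | lia]. Qed.

Lemma encnE n : encn n = enc_nat _ _ n.
Proof. by elim: n => //= n ->. Qed.

Lemma ev_wdivn env e1 e2 x n T1 T2 :
  ev env e1 (VWeight _ x) T1 -> ev env e2 (encn n) T2 ->
  ev env (EWDivn e1 e2) (VWeight _ (x / n%:R)) (T1 + T2 + n).+1.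
Proof.
rewrite encnE => -[t1 E1 le1] [t2 E2 le2].
by exists (t1 + t2 + n).+1; [econstructor; eauto | lia].
Qed.

Lemma ev_wle env e1 e2 x1 x2 T1 T2 :
  ev env e1 (VWeight _ x1) T1 -> ev env e2 (VWeight _ x2) T2 ->
  ev env (EWLe e1 e2) (enc_bool _ _ (x1 <= x2)) (T1 + T2).+1.
Proof. by case=> t1 E1 le1 [t2 E2 le2]; exists (t1 + t2).+1; [econstructor; eauto | lia]. Qed.

Ltac call_spec := match goal with IH : context [calls] |- _ => eapply IH end.

(** Symbolic execution along the syntax of the program, with result and time left as existential
    variables. Calls are resolved by [call_spec], which is redefined as more functions are
    specified; the size conditions of these specifications remain as goals. *)
Ltac run :=
  lazymatch goal with
  | |- ev _ (V _) _ _ => eapply ev_var; reflexivity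
  | |- ev _ (Fst _) _ _ => eapply ev_fst; run
  | |- ev _ (Snd _) _ _ =>
      first [solve [eapply ev_snd; run] | eapply ev_behead; run]
  | |- ev _ (Hd0 _) _ _ => eapply ev_head; run
  | |- ev _ Zero _ _ => eapply ev_zero
  | |- ev _ (Succ _) _ _ => eapply ev_pair; run
  | |- ev _ (ELet _ _) _ _ => eapply ev_let; [run | run]
  | |- ev _ ENil _ _ => eapply ev_nil
  | |- ev _ (EPair _ _) _ _ => eapply ev_pair; [run | run]
  | |- ev _ (ECase _ _ _) _ _ =>
      eapply ev_case; [run | cbn [evcase encl encn fst snd map cat flatten foldr]; run]
  | |- ev _ (ECall _ _) _ _ =>
      eapply ev_call; [reflexivity | run | try call_spec]
  | |- ev _ (EFConst _) _ _ => eapply ev_fconst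
  | |- ev _ (EFOp _ _ _) _ _ => eapply ev_fop; [run | run]
  | |- ev _ (EFEq _ _) _ _ => eapply ev_feq; [run | run]
  | |- ev _ (EWConst _) _ _ => eapply ev_wconst
  | |- ev _ (EWOp _ _ _) _ _ => eapply ev_wop; [run | run]
  | |- ev _ (EWDivn _ _) _ _ => eapply ev_wdivn; [run | run]
  | |- ev _ (EWLe _ _) _ _ => eapply ev_wle; [run | run]
  | |- _ => idtac
  end.

(** Resumes an execution stopped at a test, once the outcome E of the test is known. *)
Ltac run_bool E := rewrite E;
  cbn [evcase enc_bool enc_nat enc_seq nseq ncons iter foldr nat_of_bool]; run.

Ltac enter :=
  lazymatch goal with |- calls ?k ?v ?v' ?T =>
    let b := eval hnf in (nth ENil decoder k) in change (ev [:: v] b v' T)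
  end.

(* N bounds the sizes of all data; since it is at least 100, the constant costs
   inside a function body are absorbed by one more factor N. *)
Variable N : nat.
Hypothesis N_ge : (100 <= N)%N.

(** Locked, so that [lia] sees the powers of N as atoms, related only by the inequalities
    [pw_step]. *)
Definition pw k := locked (expn N k).

Lemma pwS k : pw k.+1 = (N * pw k)%N.
Proof. by rewrite /pw -!lock expnS. Qed.

Lemma pw1 : pw 1 = N.
Proof. by rewrite /pw -!lock expn1. Qed.

Lemma pw_step k : (100 * pw k <= pw k.+1)%N.
Proof. by rewrite pwS leq_mul2r N_ge orbT. Qed.

Lemma pw_mul n k : (n <= N)%N -> (n * pw k <= pw k.+1)%N.
Proof. by move=> le_n; rewrite pwS leq_mul2r le_n orbT. Qed.


Ltac bound := simpl; move: N_ge (pw1) (pw_step 1) (pw_step 2)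
  (pw_step 3) (pw_step 4) (pw_step 5) (pw_step 6) (pw_step 7) (pw_step 8)
  (pw_step 9) (pw_step 10); lia.

(** * Specification and running time of each function *)

Ltac solve_call := enter; eapply ev_weak; [run | try reflexivity | try bound].

(** The pattern for all recursions on a list: one round costs at most [pw k], induction gives size +
    1 such rounds, and a size below N turns this into [pw k.+1]. *)
Lemma calls_horner p a : (size p < N)%N ->
  calls f_horner (VPair (encP p) (VField _ a)) (VField _ (horner_rec p a)) (pw 2).
Proof.
move=> ltN; apply: (@calls_weak _ _ _ ((size p).+1 * pw 1)); last exact: pw_mul.
by elim: p {ltN} => [|x p IHp]; solve_call.
Qed.

Lemma calls_padd p q : (size p < N)%N ->
  calls f_padd (VPair (encP p) (encP q)) (encP (padd p q)) (pw 2).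
Proof.
move=> ltN; apply: (@calls_weak _ _ _ ((size p).+1 * pw 1)); last exact: pw_mul.
by elim: p q {ltN} => [|x p IHp] [|y q]; solve_call.
Qed.

Lemma calls_pscale c p : (size p < N)%N ->
  calls f_pscale (VPair (VField _ c) (encP p)) (encP (pscale c p)) (pw 2).
Proof.
move=> ltN; apply: (@calls_weak _ _ _ ((size p).+1 * pw 1)); last exact: pw_mul.
by elim: p {ltN} => [|x p IHp]; solve_call.
Qed.

Ltac call_spec ::= first
  [ match goal with IH : context [calls] |- _ => eapply IH end
  | eapply calls_horner | eapply calls_pscale
  | eapply (calls_padd (p := _ :: _)) | eapply calls_padd ].

Ltac side := rewrite ?size_neg_sdiv; cbn [size fst snd] in *; lia.

Lemma calls_pmulX a p : ((size p).+1 < N)%N ->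
  calls f_pmulX (VPair (VField _ a) (encP p)) (encP (pmulX a p)) (pw 3).
Proof. by move=> ltN; solve_call; side. Qed.

Lemma calls_pcomb c p d q : (size p < N)%N -> (size q < N)%N ->
  calls f_pcomb (VPair (VField _ c) (VPair (encP p) (VPair (VField _ d) (encP q))))
    (encP (pcomb c p d q)) (pw 3).
Proof. by move=> ltp ltq; solve_call; rewrite ?size_pscale. Qed.

Lemma calls_wb_eval Q a f : (size Q.1 < N)%N -> (size Q.2 < N)%N ->
  calls f_wb_eval (VPair (encQ Q) (VPair (VField _ a) (VField _ f)))
    (VField _ (wb_eval Q a f)) (pw 3).
Proof. by move=> lt1 lt2; solve_call. Qed.

Lemma calls_strip A B : (size B < N)%N ->
  calls f_strip (VPair (encP A) (encP B)) (encQ (strip A B)) (pw 2).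
Proof.
move=> ltN; apply: (@calls_weak _ _ _ ((size B).+1 * pw 1)); last exact: pw_mul.
elim: B A {ltN} => [|y B IHB] A; first by solve_call.
rewrite /=; case Ey: (y == 0); enter; (eapply ev_weak; [run; run_bool Ey|reflexivity|bound]).
Qed.

Lemma calls_sdiv n A B : (n < N)%N -> (size A < N)%N -> (size B < N)%N ->
  calls f_sdiv (VPair (encn n) (VPair (encP A) (encP B))) (encP (neg_sdiv n A B)) (pw 4).
Proof.
move=> ltn ltA ltB; apply: (@calls_weak _ _ _ (n.+1 * pw 3)); last exact: pw_mul.
elim: n A ltA {ltn} => [|n IHn] A ltA; solve_call; rewrite ?size_pscale //.
by rewrite size_behead size_padd size_pscale; lia.
Qed.

Lemma calls_dist g (col : seq (F * (F * R))) : (size g < N)%N -> (size col < N)%N ->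
  calls f_dist (VPair (encP g) (encl encpt col))
    (VWeight _ (dist_on col (horner_rec g))) (pw 4).
Proof.
move=> ltg ltc; apply: (@calls_weak _ _ _ ((size col).+1 * pw 3)); last exact: pw_mul.
elim: col {ltc} => [|t col IHcol]; first by solve_call; rewrite /dist_on big_nil.
rewrite /dist_on big_cons /gap; case Et: (t.2.1 == horner_rec g t.1).
  by enter; eapply ev_weak; [run; [side | run_bool Et] | reflexivity | bound].
by enter; eapply ev_weak; [run; [side | run_bool Et] | reflexivity | bound].
Qed.

Lemma calls_last p : (size p < N)%N ->
  calls f_last (encP p) (VField _ (last 0 p)) (pw 2).
Proof.
move=> ltN; apply: (@calls_weak _ _ _ ((size p).+1 * pw 1)); last exact: pw_mul.
by elim: p {ltN} => [|x [|y p] IHp]; solve_call.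
Qed.

Ltac call_spec ::= first
  [ match goal with IH : context [calls] |- _ => eapply IH end
  | eapply calls_horner | eapply calls_pmulX | eapply calls_pcomb
  | eapply calls_wb_eval | eapply calls_strip
  | eapply (calls_sdiv (n := _.+1)) | eapply calls_sdiv
  | eapply calls_dist | eapply calls_last ].

Lemma calls_wb_step (Q1 Q2 : seq F * seq F) d a f n :
    (n.+1 < N)%N -> (size Q1.1 <= n)%N -> (size Q1.2 <= n)%N ->
    (size Q2.1 <= n)%N -> (size Q2.2 <= n)%N ->
  calls f_wb_step
    (VPair (encst (Q1, (Q2, d))) (VPair (VField _ a) (VField _ f)))
    (encst (wb_step (Q1, (Q2, d)) a f)) (pw 4).
Proof.
move=> ltN le11 le12 le21 le22; rewrite /=; case Ec: (wb_eval Q1 a f == 0).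
  by enter; eapply ev_weak; [run; [side | side | run_bool Ec; side] | reflexivity | bound].
case: d => [|d]; enter; (eapply ev_weak; [run; [side | side | run_bool Ec; side] | reflexivity | bound]).
Qed.

(** The running time depends on the lengths of the lists, which are not normalized and may exceed
    the degrees. They grow by at most one per point. *)
Lemma size_wb_step (Q1 Q2 : seq F * seq F) d a f n :
    (size Q1.1 <= n)%N -> (size Q1.2 <= n)%N ->
    (size Q2.1 <= n)%N -> (size Q2.2 <= n)%N ->
  let st := wb_step (Q1, (Q2, d)) a f in
  [/\ (size st.1.1 <= n.+1)%N, (size st.1.2 <= n.+1)%N,
      (size st.2.1.1 <= n.+1)%N & (size st.2.1.2 <= n.+1)%N].
Proof.
move=> le11 le12 le21 le22 /=; case: ifP => _ /=; last case: d => [|d] /=.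
all: by rewrite !(size_pmulX, size_pcomb); split; lia.
Qed.

Lemma calls_wb_loop (col rest : seq (F * (F * R))) j e Q1 Q2 d n :
    (n + size rest < N)%N -> (size Q1.1 <= n)%N -> (size Q1.2 <= n)%N ->
    (size Q2.1 <= n)%N -> (size Q2.2 <= n)%N ->
    (size col < N)%N -> (j.+1 < N)%N -> (e < N)%N ->
  calls f_wb_loop
    (VPair (encl encpt col) (VPair (encn j.+1) (VPair (encn e)
       (VPair (encst (Q1, (Q2, d))) (encl encpt rest)))))
    (encE (wb_loop col j e (Q1, (Q2, d)) rest)) (pw 6).
Proof.
move=> ltN le11 le12 le21 le22 ltc ltj lte.
apply: (@calls_weak _ _ _ ((size rest).+1 * pw 5)); last by apply: pw_mul; lia.
elim: rest n Q1 Q2 d ltN le11 le12 le21 le22 => [|t rest IH] n Q1 Q2 d ltN le11 le12 le21 le22.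
  by solve_call.
have step := @calls_wb_step Q1 Q2 d t.1 t.2.1 n _ le11 le12 le21 le22.
have := size_wb_step d t.1 t.2.1 le11 le12 le21 le22.
have {step} := step ltac:(side).
case Ew: (wb_step _ _ _) => [Q1' [Q2' d']] step [sz11 sz12 sz21 sz22].
have {}IH := IH n.+1; have [szA szB] := size_strip Q1'.1 Q1'.2.
rewrite (wb_loop_cons _ Ew erefl erefl).
set v := dist_on _ _ / _; case Ev: (1 <= v).
  by enter; eapply ev_weak; [run; [side..| run_bool Ev; side] | reflexivity | bound].
by enter; eapply ev_weak; [run; [side..| run_bool Ev; side] | reflexivity | bound].
Qed.

Lemma calls_insert (t : F * (F * R)) l : (size l < N)%N ->
  calls f_insert (VPair (encpt t) (encl encpt l)) (encl encpt (insert t l)) (pw 2).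
Proof.
move=> ltN; apply: (@calls_weak _ _ _ ((size l).+1 * pw 1)); last exact: pw_mul.
elim: l {ltN} => [|t' l IHl]; first by solve_call.
rewrite /=; case Et: (t.2.2 <= t'.2.2).
  by enter; eapply ev_weak; [run; run_bool Et | reflexivity | bound].
by enter; eapply ev_weak; [run; run_bool Et | reflexivity | bound].
Qed.

Ltac call_spec ::= first
  [ match goal with IH : context [calls] |- _ => eapply IH end
  | eapply calls_insert ].

Lemma calls_sort (l : seq (F * (F * R))) : (size l < N)%N ->
  calls f_sort (encl encpt l) (encl encpt (insertion_sort l)) (pw 4).
Proof.
move=> ltN; apply: (@calls_weak _ _ _ ((size l).+1 * pw 3)); last exact: pw_mul.
elim: l ltN => [|t l IHl] /= ltN; first by solve_call.
have {}IHl := IHl (ltnW ltN); solve_call.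
by rewrite (perm_size (perm_insertion_sort l)) ltnW.
Qed.

Lemma calls_udecode (col : seq (F * (F * R))) j e :
    ((size col).+1 < N)%N -> (j.+1 < N)%N -> (e < N)%N ->
  calls f_udecode (VPair (encn j.+1) (VPair (encn e) (encl encpt col)))
    (encE (udecode j e col)) (pw 7).
Proof.
move=> ltc ltj lte; have sort := calls_sort (ltnW ltc).
have loop := @calls_wb_loop col (insertion_sort col) j e
  ([:: 1], [::]) ([::], [:: 1]) j 1.
rewrite (perm_size (perm_insertion_sort col)) in loop.
rewrite add1n in loop; have {}loop := loop ltc isT isT isT isT (ltnW ltc) ltj lte.
solve_call.
Qed.

Ltac call_spec ::= first
  [ match goal with IH : context [calls] |- _ => eapply IH end
  | eapply (calls_udecode (j := _)) ].

Lemma calls_udecode_all (cols : seq (seq (F * (F * R)))) j e :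
    {in cols, forall col, (size col).+1 < N}%N -> (j.+1 < N)%N -> (e < N)%N ->
    (size cols < N)%N ->
  calls f_udecode_all (VPair (encn j.+1) (VPair (encn e) (encl (encl encpt) cols)))
    (encl encE [seq udecode j e col | col <- cols]) (pw 9).
Proof.
move=> ltc ltj lte lts.
apply: (@calls_weak _ _ _ ((size cols).+1 * pw 8)); last exact: pw_mul.
elim: cols {lts} ltc => [|col cols IHc] ltc; first by solve_call.
have {}IHc : calls _ _ _ ((size cols).+1 * pw 8) := IHc (fun c (cc : c \in cols) => ltc c (mem_behead (s := _ :: _) cc)).
have dcol := calls_udecode (ltc col (mem_head _ _)) ltj lte.
solve_call.
Qed.

Lemma calls_pow a j : (j < N)%N ->
  calls f_pow (VPair (VField _ a) (encn j)) (VField _ (a ^+ j)) (pw 2).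
Proof.
move=> ltN; apply: (@calls_weak _ _ _ (j.+1 * pw 1)); last exact: pw_mul.
by elim: j {ltN} => [|j IHj]; rewrite ?exprS; solve_call.
Qed.

Ltac call_spec ::= first
  [ match goal with IH : context [calls] |- _ => eapply IH end
  | eapply calls_pow ].

Lemma calls_sub_column (col : seq (F * (F * R))) j y :
    (j < N)%N -> (size col < N)%N ->
  calls f_sub_column (VPair (encn j) (VPair (VField _ y) (encl encpt col)))
    (encl encpt [seq (t.1, (t.2.1 - t.1 ^+ j * y, t.2.2)) | t <- col]) (pw 4).
Proof.
move=> ltj ltN; apply: (@calls_weak _ _ _ ((size col).+1 * pw 3)); last exact: pw_mul.
by elim: col {ltN} => [|t col IHc]; solve_call; side.
Qed.

Ltac call_spec ::= first
  [ match goal with IH : context [calls] |- _ => eapply IH end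
  | eapply calls_sub_column ].

Lemma calls_sub_columns (X : Type) (xs : seq X) (col : X -> seq (F * (F * R)))
    (w r : X -> F * R) j :
    (j < N)%N -> (forall x, size (col x) < N)%N -> (size xs < N)%N ->
  calls f_sub_columns
    (VPair (encn j) (VPair (encl (encl encpt) [seq col x | x <- xs])
      (VPair (encl encE [seq w x | x <- xs]) (encl encE [seq r x | x <- xs]))))
    (encl (encl encpt) [seq [seq (t.1, (t.2.1 - t.1 ^+ j * ((w x).1 - (r x).1), t.2.2))
       | t <- col x] | x <- xs]) (pw 6).
Proof.
move=> ltj ltc ltN; apply: (@calls_weak _ _ _ ((size xs).+1 * pw 5)); last exact: pw_mul.
by elim: xs {ltN} => [|x xs IHx]; solve_call.
Qed.

Lemma calls_eqn i j : (i < N)%N ->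
  calls f_eqn (VPair (encn i) (encn j)) (enc_bool _ _ (i == j)) (pw 2).
Proof.
move=> ltN; apply: (@calls_weak _ _ _ (i.+1 * pw 1)); last exact: pw_mul.
by elim: i j {ltN} => [|i IHi] [|j]; solve_call.
Qed.

Ltac call_spec ::= first
  [ match goal with IH : context [calls] |- _ => eapply IH end
  | eapply calls_eqn ].

Lemma calls_slice j D : (size D < N)%N ->
    {in D, forall b, if b is i :: _ then (i < N)%N else true} ->
  calls f_slice (VPair (encn j) (encl encb D)) (encl encb (slice j D)) (pw 4).
Proof.
move=> ltN ltD; apply: (@calls_weak _ _ _ ((size D).+1 * pw 3)); last exact: pw_mul.
elim: D {ltN} ltD => [|b D IHD] ltD; first by solve_call.
have {}IHD : calls _ _ _ ((size D).+1 * pw 3) := IHD (fun c (cc : c \in D) => ltD c (mem_behead (s := _ :: _) cc)).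
case: b ltD => [|i b] ltD; first by solve_call.
have /= lti := ltD _ (mem_head _ _).
rewrite /slice /= (_ : (Some i == Some j) = (i == j)) //; case Eij: (i == j).
  by enter; eapply ev_weak; [run; [side | run_bool Eij] | reflexivity | bound].
by enter; eapply ev_weak; [run; [side | run_bool Eij] | reflexivity | bound].
Qed.

Lemma calls_prefix j (ts acc : seq (seq nat * F)) : (size ts < N)%N ->
  calls f_prefix (VPair (encn j) (VPair (encl enct ts) (encl enct acc)))
    (encl enct (prefix_terms j ts acc)) (pw 2).
Proof.
move=> ltN; apply: (@calls_weak _ _ _ ((size ts).+1 * pw 1)); last exact: pw_mul.
by elim: ts {ltN} => [|t ts IHt]; solve_call.
Qed.

(** * Conversion between tables and columns *)

Lemma calls_length (s : seq F) : (size s < N)%N ->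
  calls f_length (encP s) (encn (size s)) (pw 2).
Proof.
move=> ltN; apply: (@calls_weak _ _ _ ((size s).+1 * pw 1)); last exact: pw_mul.
by elim: s {ltN} => [|x s IHs]; solve_call.
Qed.

Lemma calls_cut s (w : F -> F * R) tab : (size s < N)%N ->
  calls f_cut (VPair (encP s) (encl encE ([seq w a | a <- s] ++ tab)))
    (VPair (encl encpt [seq (a, w a) | a <- s]) (encl encE tab)) (pw 2).
Proof.
move=> ltN; apply: (@calls_weak _ _ _ ((size s).+1 * pw 1)); last exact: pw_mul.
by elim: s {ltN} => [|a s IHs]; solve_call.
Qed.

(** The set is nonempty because the number of columns is read off the table, which an empty set
    would leave empty. *)
Lemma calls_columns (a : F) s (w : seq F -> F * R) xs :
    (size (a :: s) < N)%N -> (size xs < N)%N ->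
  calls f_columns (VPair (encP (a :: s))
      (encl encE (flatten [seq [seq w (b :: x) | b <- a :: s] | x <- xs])))
    (encl (encl encpt) [seq column (a :: s) w x | x <- xs]) (pw 4).
Proof.
move=> lts ltN; apply: (@calls_weak _ _ _ ((size xs).+1 * pw 3)); last exact: pw_mul.
elim: xs {ltN} => [|x xs IHx]; first by solve_call.
have cut := @calls_cut (a :: s) (fun b => w (b :: x))
  (flatten [seq [seq w (b :: x) | b <- a :: s] | x <- xs]) lts.
solve_call.
Qed.

Lemma calls_snd_app (col : seq (F * (F * R))) acc : (size col < N)%N ->
  calls f_snd_app (VPair (encl encpt col) (encl encE acc))
    (encl encE ([seq t.2 | t <- col] ++ acc)) (pw 2).
Proof.
move=> ltN; apply: (@calls_weak _ _ _ ((size col).+1 * pw 1)); last exact: pw_mul.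
by elim: col {ltN} => [|t col IHc]; solve_call.
Qed.

Ltac call_spec ::= first
  [ match goal with IH : context [calls] |- _ => eapply IH end
  | eapply calls_snd_app ].

Lemma calls_flatten (X : Type) (xs : seq X) (col : X -> seq (F * (F * R))) :
    (forall x, size (col x) < N)%N -> (size xs < N)%N ->
  calls f_flatten (encl (encl encpt) [seq col x | x <- xs])
    (encl encE (flatten [seq [seq t.2 | t <- col x] | x <- xs])) (pw 4).
Proof.
move=> ltc ltN; apply: (@calls_weak _ _ _ ((size xs).+1 * pw 3)); last exact: pw_mul.
by elim: xs {ltN} => [|x xs IHx]; solve_call.
Qed.

Lemma calls_rev (X : Type) (f : X -> value) l acc : (size l < N)%N ->
  calls f_rev (VPair (encl f l) (encl f acc)) (encl f (catrev l acc)) (pw 2).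
Proof.
move=> ltN; apply: (@calls_weak _ _ _ ((size l).+1 * pw 1)); last exact: pw_mul.
elim: l acc {ltN} => [|x l IHl] acc; first by solve_call.
have {}IHl := IHl (x :: acc); solve_call.
Qed.

Ltac call_spec ::= first
  [ match goal with IH : context [calls] |- _ => eapply IH end
  | eapply (@calls_rev _ _ _ [::]) ].

Lemma calls_rev_all D : (size D < N)%N -> {in D, forall b, size b < N}%N ->
  calls f_rev_all (encl encb D) (encl encb [seq rev b | b <- D]) (pw 4).
Proof.
move=> ltN ltb; apply: (@calls_weak _ _ _ ((size D).+1 * pw 3)); last exact: pw_mul.
elim: D {ltN} ltb => [|b D IHD] ltb; first by solve_call.
have {}IHD : calls _ _ _ ((size D).+1 * pw 3) := IHD (fun c (cc : c \in D) => ltb c (mem_behead (s := _ :: _) cc)).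
by have ltb0 := ltb b (mem_head _ _); solve_call.
Qed.

Lemma calls_rev_terms (ts : seq (seq nat * F)) :
    (size ts < N)%N -> {in ts, forall t, size t.1 < N}%N ->
  calls f_rev_terms (encl enct ts) (encl enct [seq (rev t.1, t.2) | t <- ts]) (pw 4).
Proof.
move=> ltN ltt; apply: (@calls_weak _ _ _ ((size ts).+1 * pw 3)); last exact: pw_mul.
elim: ts {ltN} ltt => [|t ts IHt] ltt; first by solve_call.
have {}IHt : calls _ _ _ ((size ts).+1 * pw 3) := IHt (fun c (cc : c \in ts) => ltt c (mem_behead (s := _ :: _) cc)).
by have ltt0 := ltt t (mem_head _ _); solve_call.
Qed.

Definition residual (w : seq F -> F * R) ts x : F * R :=
  ((w x).1 - terms_eval ts x, (w x).2).

Ltac call_spec ::= match goal with IH : context [calls] |- _ => eapply IH end.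

Lemma size_grid_cons (s : seq F) S : size (grid (s :: S)) = (size (grid S) * size s)%N.
Proof. by rewrite /= size_allpairs. Qed.

(** The two functions are mutually recursive; the last hypothesis is the induction hypothesis of
    [calls_decode]. The terms in [acc] have already been subtracted from w and occur again in [ts],
    so the final word is w + acc - ts, an expression that each round preserves. *)
Lemma calls_loop (s : seq F) (S : seq (seq F)) (D : seq (seq nat)) :
    ((size s).+1 < N)%N -> (size (grid S) < N)%N -> (size D < N)%N ->
    all (box (s :: S)) D ->
    (forall j w, calls f_decode
       (VPair (encl encP S) (VPair (encl encb (slice j D)) (encl encE [seq w x | x <- grid S])))
       (VPair (encl enct (decode S (slice j D) w))
              (encl encE [seq residual w (decode S (slice j D) w) x | x <- grid S]))
       (pw 1 + size (slice j D) * size S * pw 12)) ->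
  forall n e acc w, (n + e)%N = size s ->
  let ts := decode_loop (decode S) s D n e w acc in
  calls f_loop
    (VPair (encl encP S) (VPair (encl encb D)
      (VPair (encl (encl encpt) [seq column s w x | x <- grid S])
        (VPair (encn n) (VPair (encn e) (encl enct acc))))))
    (VPair (encl enct ts) (encl (encl encpt) [seq column s
       (fun y => ((w y).1 + terms_eval acc y - terms_eval ts y, (w y).2)) x | x <- grid S]))
    (pw 2 + \sum_(l < n) (pw 10 + (pw 1 + size (slice l D) * size S * pw 12))).
Proof.
move=> lts ltg ltD boxD dec_spec; elim=> [|j IHj] e acc w eq_k ts.
  have Ecol x : column s (fun y => ((w y).1 + terms_eval acc y - terms_eval ts y, (w y).2)) x
    = column s w x.
    by apply: eq_map => a /=; rewrite addrK; case: (w _).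
  by rewrite (eq_map Ecol) big_ord0; solve_call.
have sz_col x : size (column s w x) = size s by rewrite size_map.
pose w1 x := udecode j e.+1 (column s w x).
pose ts1 := decode S (slice j D) w1.
have udec : calls f_udecode_all
    (VPair (encn j.+1) (VPair (encn e.+1) (encl (encl encpt) [seq column s w x | x <- grid S])))
    (encl encE [seq w1 x | x <- grid S]) (pw 9).
  rewrite (map_comp (udecode j e.+1) (column s w)); apply: calls_udecode_all; rewrite ?size_map //.
  - by move=> _ /mapP[x _ ->]; rewrite sz_col.
  - by lia.
  - by lia.
have slice_spec : calls f_slice (VPair (encn j) (encl encb D)) (encl encb (slice j D)) (pw 4).
  apply: calls_slice => // -[|i b] //= /(allP boxD) /= /andP[lt_i _]; lia.
have {}dec_spec := dec_spec j w1; rewrite -/ts1 in dec_spec.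
have sub : calls f_sub_columns (VPair (encn j)
      (VPair (encl (encl encpt) [seq column s w x | x <- grid S])
        (VPair (encl encE [seq w1 x | x <- grid S])
               (encl encE [seq residual w1 ts1 x | x <- grid S]))))
    (encl (encl encpt) [seq column s (sub_terms j ts1 w) x | x <- grid S]) (pw 6).
  have Ecol x : column s (sub_terms j ts1 w) x = [seq (t.1, (t.2.1 - t.1 ^+ j *
      ((w1 x).1 - (residual w1 ts1 x).1), t.2.2)) | t <- column s w x].
    by rewrite /column -map_comp; apply: eq_map => a /=; rewrite subKr.
  rewrite (eq_map Ecol).
  apply: calls_sub_columns => //; first by lia.
  by move=> x; rewrite sz_col; lia.
have prefix : calls f_prefix (VPair (encn j) (VPair (encl enct ts1) (encl enct acc)))
    (encl enct (prefix_terms j ts1 acc)) (pw 2).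
  apply: calls_prefix; apply: leq_ltn_trans (size_decode _ _ _) _.
  exact: leq_ltn_trans (size_slice _ _) ltD.
have {IHj} loop := IHj e.+1 (prefix_terms j ts1 acc) (sub_terms j ts1 w) ltac:(lia).
cbv zeta in loop; rewrite -[decode_loop _ _ _ _ _ _ _]/ts in loop.
have Ecol x : column s (fun y => ((sub_terms j ts1 w y).1
      + terms_eval (prefix_terms j ts1 acc) y - terms_eval ts y, (sub_terms j ts1 w y).2)) x
    = column s (fun y => ((w y).1 + terms_eval acc y - terms_eval ts y, (w y).2)) x.
  apply: eq_map => a /=; rewrite terms_eval_prefix.
  by congr (_, (_, _)); ring.
rewrite (eq_map Ecol) in loop; rewrite big_ord_recr /=.
by solve_call.
Qed.

(** The summand [pw 1] pays for a call with empty D. Otherwise the call has |D| [pw 12] of its own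
    for the current coordinate, which covers the rounds of the loop and the fixed cost of up to N
    recursive calls; the remaining budgets of the slices add up to at most |D| |S| [pw 12] over the
    smaller grid. *)
Lemma calls_decode (S : seq (seq F)) (D : seq (seq nat)) w :
    all (fun s : seq F => (0 < size s) && ((size s).+1 < N))%N S ->
    (size (grid S) < N)%N -> (size D < N)%N -> all (box S) D ->
  calls f_decode
    (VPair (encl encP S) (VPair (encl encb D) (encl encE [seq w x | x <- grid S])))
    (VPair (encl enct (decode S D w))
           (encl encE [seq residual w (decode S D w) x | x <- grid S]))
    (pw 1 + size D * size S * pw 12).
Proof.
elim: S D w => [|s S IHS] D w.
  case: D => [|b D] _ _ _ _.
    by enter; eapply ev_weak; [run | rewrite /= /residual /terms_eval big_nil subr0; case: (w _) | bound].
  enter; eapply ev_weak; [run | | bound].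
  by rewrite /= /residual /terms_eval big_seq1 /= mulr1 subrr.
case: D => [|b D].
  move=> *; enter; eapply ev_weak; [run | | bound].
  rewrite [decode _ _ _]/= [encl enct _]/=; congr (VPair _ (encl encE _)).
  by apply: eq_map => x; rewrite /residual /terms_eval big_nil subr0; case: (w _).
set D' := b :: D; rewrite size_grid_cons => /andP[/andP[s_gt0 lts] okS] ltg ltD boxD.
have ltg' : (size (grid S) < N)%N by apply: leq_ltn_trans ltg; rewrite leq_pmulr.
have dec_spec j w1 := IHS (slice j D') w1 okS ltg' (leq_ltn_trans (size_slice _ _) ltD)
  (box_slice _ boxD).
have gridE (X : Type) (f : seq F -> X) :
    [seq f y | y <- grid (s :: S)] = flatten [seq [seq f (a :: x) | a <- s] | x <- grid S].
  rewrite /= map_flatten -map_comp; congr flatten; apply: eq_map => x /=.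
  by rewrite -map_comp.
have columns : calls f_columns (VPair (encP s) (encl encE [seq w y | y <- grid (s :: S)]))
    (encl (encl encpt) [seq column s w x | x <- grid S]) (pw 4).
  by rewrite gridE; case: (s) s_gt0 lts => // a s' _ lts'; apply: calls_columns => //; apply: ltnW.
have length := calls_length (ltnW lts).
have := @calls_loop s S D' lts ltg' ltD boxD dec_spec (size s) 0 [::] w (addn0 _).
cbv zeta; rewrite -[decode_loop _ _ _ _ _ _ _]/(decode (s :: S) D' w); set ts := decode _ _ _.
pose w' y := ((w y).1 + terms_eval [::] y - terms_eval ts y, (w y).2).
move=> loop.
have flat : calls f_flatten (encl (encl encpt) [seq column s w' x | x <- grid S])
    (encl encE [seq residual w ts y | y <- grid (s :: S)]) (pw 4).
  have Ecol x : [seq residual w ts (a :: x) | a <- s] = [seq t.2 | t <- column s w' x].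
    rewrite /column -map_comp; apply: eq_map => a /=.
    by rewrite /w' /residual {2}/terms_eval big_nil addr0.
  rewrite gridE (eq_map Ecol).
  by apply: calls_flatten => // x; rewrite size_map; lia.
have le_sum : (\sum_(l < size s) (pw 10 + (pw 1 + size (slice l D') * size S * pw 12))
    <= pw 11 + pw 2 + size D' * size S * pw 12)%N.
  rewrite !big_split /= !sum_nat_const !card_ord -!big_distrl /= addnA.
  have leN : (size s <= N)%N by lia.
  by rewrite !leq_add ?pw_mul // !leq_mul ?sum_size_slice.
have le_D : (pw 12 <= size D' * pw 12)%N by rewrite leq_pmull.
rewrite /D'; enter; eapply ev_weak; [run | reflexivity |]; rewrite -/D'.
move: le_sum le_D (pw_step 11); rewrite [size (s :: S)]/= mulnS mulnDl.
by set big := (\sum_(l < _) _)%N; set DS := (_ * size S * _)%N; bound.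
Qed.

Lemma calls_main (S : seq (seq F)) (D : seq (seq nat)) w :
    all (fun s : seq F => (0 < size s) && ((size s).+1 < N))%N S ->
    (size S < N)%N -> (size (grid (rev S)) < N)%N -> (size D < N)%N ->
    all (box S) D ->
  calls f_main
    (VPair (encl encP S)
      (VPair (encl encb D) (encl encE [seq w x | x <- grid (rev S)])))
    (encl enct [seq (rev t.1, t.2) | t <- decode (rev S) [seq rev b | b <- D] w])
    (pw 15).
Proof.
move=> okS ltS ltg ltD boxD.
have rev_S := @calls_rev _ encP S [::] ltS.
have szD b : b \in D -> size b = size S by move/(allP boxD)/box_size.
have rev_D := @calls_rev_all D ltD.
have {}rev_D : calls _ _ _ _ := rev_D (fun b Db => eq_ind_r (fun n => n < N)%N ltS (szD b Db)).
set D' := [seq rev b | b <- D] in rev_D *.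
have szD' : size D' = size D by rewrite size_map.
have dec := @calls_decode (rev S) D' w.
have {dec} : calls f_decode _ _ _ := dec _ ltg _ _.
rewrite all_rev szD' => /(_ okS ltD)/(_ _)/wrap[|].
  apply/allP=> _ /mapP[b /(allP boxD) + ->]; rewrite /box !all2E !size_rev.
  by case/andP=> /eqP eq_sz all_b; rewrite eq_sz eqxx -rev_zip // all_rev.
set ts := decode _ _ _ => dec.
have rev_ts : calls f_rev_terms (encl enct ts) (encl enct [seq (rev t.1, t.2) | t <- ts]) (pw 4).
  apply: calls_rev_terms.
    by apply: leq_ltn_trans (size_decode _ _ _) _; rewrite szD'.
  move=> t /decode_supp => /(_ _)/wrap[|/mapP[b Db ->]].
    by move=> _ /mapP[b Db ->]; rewrite !size_rev szD.
  by rewrite size_rev szD.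
enter; eapply ev_weak; [run | reflexivity |].
have le12 : (size D * size (rev S) * pw 12 <= pw 14)%N.
  by rewrite -mulnA size_rev (pwS 13) leq_mul ?pw_mul // ltnW.
by move: le12 (pw_step 11) (pw_step 12) (pw_step 13) (pw_step 14); bound.
Qed.

End Implementation.

(** * From lists to multivariate polynomials *)

Section Translation.
Variables (F : fieldType) (R : realFieldType).

Lemma mono_eval_zip (b : seq nat) (x : seq F) :
  mono_eval b x = \prod_(u <- zip b x) u.2 ^+ u.1.
Proof. by elim: b x => [|i b IHb] [|a x]; rewrite ?big_nil ?big_cons //= IHb. Qed.

Lemma mono_eval_rev (b : seq nat) (x : seq F) :
  size b = size x -> mono_eval (rev b) (rev x) = mono_eval b x.
Proof. by move=> eq_sz; rewrite !mono_eval_zip -rev_zip // big_rev. Qed.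

Lemma grid_rcons (S : seq (seq F)) (s : seq F) :
  grid (rcons S s) = [seq rcons x a | a <- s, x <- grid S].
Proof.
elim: S => [|t S IHS] /=; first by elim: s => //= a s ->.
rewrite {}IHS; elim: s => //= a s IHs; rewrite allpairs_cat IHs; congr (_ ++ _).
by rewrite allpairs_mapl map_allpairs.
Qed.

Section Fixed.
Variable m : nat.
Implicit Types (S : m.-tuple (seq F)) (D : seq 'X_{1..m}) (w : m.-tuple F -> F * R).
Implicit Types (a : 'X_{1..m}) (b : seq nat) (x : m.-tuple F).

Definition mnm_list a : seq nat := [seq a i | i <- enum 'I_m].
Definition list_mnm b : 'X_{1..m} := [multinom nth 0%N b i | i < m].

Lemma size_mnm_list a : size (mnm_list a) = m.
Proof. by rewrite size_map size_enum_ord. Qed.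

Lemma nth_mnm_list a (i : 'I_m) : nth 0%N (mnm_list a) i = a i.
Proof. by rewrite (nth_map i) ?size_enum_ord // nth_ord_enum. Qed.

Lemma mnm_listK a : list_mnm (mnm_list a) = a.
Proof. by apply/mnmP=> i; rewrite mnmE nth_mnm_list. Qed.

Lemma list_mnmK b : size b = m -> mnm_list (list_mnm b) = b.
Proof.
move=> szb; apply: (@eq_from_nth _ 0%N); rewrite size_mnm_list // => i lt_i.
by rewrite (nth_mnm_list _ (Ordinal lt_i)) mnmE.
Qed.

Lemma mono_eval_mnm a x : mono_eval (mnm_list a) x = ('X_[a]).@[tnth x].
Proof.
rewrite mevalX mono_eval_zip -[tval x]map_tnth_enum /mnm_list.
rewrite (_ : zip _ _ = [seq (a i, tnth x i) | i <- enum 'I_m]).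
  by rewrite big_map big_enum.
by elim: (enum _) => //= i e ->.
Qed.

Definition rev_mnm a := rev (mnm_list a).

Lemma rev_mnm_inj : injective rev_mnm.
Proof. by move=> a a' /(inv_inj revK) eq_a; rewrite -[a]mnm_listK eq_a mnm_listK. Qed.

Lemma mono_eval_rev_mnm a x : mono_eval (rev_mnm a) (rev x) = ('X_[a]).@[tnth x].
Proof. by rewrite mono_eval_rev ?mono_eval_mnm // size_mnm_list size_tuple. Qed.

(* Only lists of length m matter; others get an arbitrary value. *)
Definition list_word w (y : seq F) : F * R :=
  if insub (rev y) is Some x then w x else (0, 0).

Lemma list_wordE w x : list_word w (rev x) = w x.
Proof. by rewrite /list_word revK valK. Qed.

Lemma meval_comb D (p : {mpoly F[m]}) x :
    uniq D -> in_span D p ->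
  comb [seq rev_mnm a | a <- D] (fun b => p@_(list_mnm (rev b))) (rev x) = p.@[tnth x].
Proof.
move=> uniqD spanp; rewrite mevalE /comb big_map (bigID (mem (msupp p))) /=.
rewrite [X in _ + X]big1 ?addr0 => [|a /memN_msupp_eq0 p0]; last first.
  by rewrite revK mnm_listK p0 mul0r.
rewrite -big_filter; apply: etrans (_ : \sum_(a <- msupp p) _ = _).
  apply: perm_big; apply: uniq_perm => [||a]; rewrite ?filter_uniq ?msupp_uniq //.
  by rewrite mem_filter andb_idr // => /spanp.
by apply: eq_bigr => a _; rewrite revK mnm_listK mono_eval_rev_mnm mevalX.
Qed.

Definition list_poly D (c : seq nat -> F) : {mpoly F[m]} :=
  \sum_(a <- D) c (rev_mnm a) *: 'X_[a].

Lemma in_span_sum D (I : eqType) (r : seq I) (c : I -> F) (f : I -> 'X_{1..m}) :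
  {in r, forall i, f i \in D} -> in_span D (\sum_(i <- r) c i *: 'X_[f i]).
Proof.
move=> rD a; apply: contraLR => nDa; rewrite -mcoeff_eq0 raddf_sum /= big_seq big1 //.
move=> i /rD Dfi; rewrite mcoeffZ mcoeffX; case: eqP => [Ea|]; last by rewrite mulr0.
by rewrite -Ea Dfi in nDa.
Qed.

Lemma meval_list_poly D c x :
  (list_poly D c).@[tnth x] = comb [seq rev_mnm a | a <- D] c (rev x).
Proof.
rewrite /list_poly raddf_sum /comb big_map; apply: eq_bigr => a _.
by rewrite /= mevalZ mono_eval_rev_mnm.
Qed.

End Fixed.

Lemma grid_points m (S : m.-tuple (seq F)) :
  grid (rev S) = [seq rev x | x : m.-tuple F <- points S].
Proof.
elim: m S => [|m IHm] S; first by rewrite (tuple0 S).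
case/tupleP: S => s S; rewrite [points _]/= [rev _]/= rev_cons grid_rcons.
have -> : @points F m (behead_tuple [tuple of s :: S]) = points S.
  by congr points; apply: val_inj.
rewrite map_allpairs (IHm S) allpairs_mapr; congr flatten.
by apply: eq_map => a; apply: eq_map => x /=; rewrite rev_cons.
Qed.

Lemma wdist_grid m (S : m.-tuple (seq F)) (w : m.-tuple F -> F * R) g h :
  (forall x : m.-tuple F, h (rev x) = g x) ->
  2 * wdist S w g = dist_grid (rev S) (list_word w) h.
Proof.
move=> hE; rewrite /dist_grid grid_points big_map [RHS](bigID (fun x => (w x).1 == g x)) /=.
rewrite /wdist mulrDr !mulr_sumr; congr (_ + _); apply: eq_bigr => x.
  by rewrite list_wordE hE /gap => ->; field.
by rewrite list_wordE hE /gap => /negPf->; field.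
Qed.

Lemma eq_in_wdist m (S : m.-tuple (seq F)) (w : m.-tuple F -> F * R) g h :
  {in points S, g =1 h} -> wdist S w g = wdist S w h.
Proof.
move=> eq_gh; rewrite /wdist; congr (_ + _); rewrite big_seq_cond [RHS]big_seq_cond.
all: by apply: eq_bigl => x; case Sx: (x \in _); rewrite //= eq_gh.
Qed.

(** * Encoded instances and their size *)

Lemma enclE (X : Type) (f : X -> value F R) l : encl f l = enc_seq [seq f x | x <- l].
Proof. by elim: l => //= x l ->. Qed.

Lemma value_size_encl (X : Type) (f : X -> value F R) l :
  (size l < value_size (encl f l))%N.
Proof. by elim: l => //= x l IHl; case: (f x) => * /=; lia. Qed.

Lemma value_size_mem (X : eqType) (f : X -> value F R) l x :
  x \in l -> (value_size (f x) < value_size (encl f l))%N.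
Proof.
elim: l => //= y l IHl; rewrite inE => /orP[/eqP->|/IHl]; last by lia.
by have := value_size_encl f l; lia.
Qed.

Lemma enc_instanceE m (S : m.-tuple (seq F)) (D : seq 'X_{1..m}) w :
  enc_instance S D w =
  VPair (encl (encl (VField R)) S)
    (VPair (encl (encl (encn F R)) [seq mnm_list a | a <- D])
       (encl (@encE F R) [seq list_word w y | y <- grid (rev S)])).
Proof.
rewrite grid_points /enc_instance !enclE -!map_comp; congr (VPair (enc_seq _) (VPair (enc_seq _) (enc_seq _))).
- by apply: eq_map => s /=; rewrite enclE.
- apply: eq_map => a /=; rewrite enclE /mnm_list -map_comp.
  by congr enc_seq; apply: eq_map => i /=; rewrite encnE.
- by apply: eq_map => x /=; rewrite list_wordE.
Qed.

Lemma enc_termsE m (ts : seq ('X_{1..m} * F)) :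
  enc_terms R ts = encl (@enct F R) [seq (mnm_list t.1, t.2) | t <- ts].
Proof.
rewrite enclE -map_comp; congr enc_seq; apply: eq_map => t /=.
rewrite /enct /= enclE -map_comp; congr (VPair (enc_seq _) _).
by apply: eq_map => i /=; rewrite encnE.
Qed.

End Translation.

Theorem theorem2p1 (F : fieldType) (R : realFieldType) :
  exists (P : program) (c k : nat),
    forall (m : nat) (S : m.-tuple (seq F)) (D : seq 'X_{1..m})
      (w : m.-tuple F -> F * R),
    is_grid S -> is_downset S D -> is_wword S w ->
    exists (ts : seq ('X_{1..m} * F)) (t : nat),
    [/\ runs P (enc_instance S D w) (enc_terms R ts) t,
        (t <= c * value_size (enc_instance S D w) ^ k)%N
      & forall mu : nat, is_min_distance S D mu ->
        (exists2 C : m.-tuple F -> F, codeword S D C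
           & wdist S w C < mu%:R / 2) ->
        in_span D (poly_of_terms ts) /\
        wdist S w (fun x => (poly_of_terms ts).@[tnth x]) < mu%:R / 2].
Proof.
(* With N the cube of the input size, the run takes at most N^16 steps, and 48 = 3 * 16. *)
exists decoder, 1%N, 48%N => m S D w gridS [uniqD boxD downD] wt.
pose Dl := [seq mnm_list a | a <- D]; pose w' := list_word w.
pose out := decode (rev S) [seq rev b | b <- Dl] w'.
have revDl : [seq rev b | b <- Dl] = [seq rev_mnm a | a <- D] by rewrite -map_comp.
have box_Dl : all (box S) Dl.
  apply/allP=> _ /mapP[a Da ->]; rewrite /box all2E size_mnm_list size_tuple eqxx /=.
  rewrite /mnm_list -[tval S]map_tnth_enum.
  have : forall i, i \in enum 'I_m -> (a i < size (tnth S i))%N by move=> i _; apply: boxD.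
  elim: (enum _) => //= i e IHe lt_e; rewrite lt_e ?mem_head //=.
  by apply: IHe => i' ei'; apply: lt_e; rewrite inE ei' orbT.
have box_rev : all (box (rev S)) [seq rev b | b <- Dl].
  apply/allP=> _ /mapP[b /(allP box_Dl) + ->]; rewrite /box !all2E !size_rev.
  by case/andP=> /eqP eq_sz all_b; rewrite eq_sz eqxx -rev_zip // all_rev.
have out_supp : {in out, forall t, exists2 a, a \in D & t.1 = rev_mnm a}.
  move=> t /decode_supp => /(_ _)/wrap[|].
    by move=> b /(allP box_rev)/box_size.
  by rewrite revDl => /mapP.
pose ts := [seq (list_mnm m (rev t.1), t.2) | t <- out].
have encts : [seq (rev t.1, t.2) | t <- out] = [seq (mnm_list t.1, t.2) | t <- ts].
  rewrite -map_comp; apply/eq_in_map => t /out_supp[a _ Et] /=.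
  by rewrite Et /rev_mnm revK mnm_listK.
set inp := enc_instance S D w.
(* An instance consists of two pairs and three components, so its size is at least 5; the cube is
   the first power that then reaches 100. *)
pose N := (value_size inp ^ 3)%N.
have inp5 : (5 <= value_size inp)%N.
  rewrite /inp enc_instanceE /=; set v1 := encl _ _; set v2 := encl _ _; set v3 := encl _ _.
  by case: v1; case: v2; case: v3 => * /=; lia.
have ltN : (value_size inp < N)%N by rewrite -{1}(expn1 (value_size inp)) ltn_exp2l; lia.
have N100 : (100 <= N)%N by apply: leq_trans (_ : 5 ^ 3 <= _)%N; rewrite ?leq_exp2r.
have /= sizes : (value_size (encl (encl (VField R)) S) < N)%N /\
   (size Dl < N)%N /\ (size (grid (rev S)) < N)%N.
  have : (value_size inp <= N)%N by exact: ltnW.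
  rewrite {1}/inp enc_instanceE /= -/Dl -/w'.
  have := value_size_encl (encl (encn F R)) Dl.
  have := value_size_encl (@encE F R) [seq w' y | y <- grid (rev S)].
  rewrite size_map; lia.
have [ltS [ltD ltg]] := sizes.
have okS : all (fun s : seq F => (0 < size s) && ((size s).+1 < N))%N S.
  apply/allP=> s Ss; have [i Es] : exists i, s = tnth S i by apply/tnthP.
  have [_ /eqP] := gridS i; rewrite -Es -size_eq0 -lt0n => -> /=.
  apply: leq_ltn_trans ltS.
  exact: leq_trans (value_size_encl (VField R) s) (ltnW (value_size_mem _ Ss)).
have szS : (size S < N)%N by apply: ltn_trans (value_size_encl _ _) ltS.
have call := calls_main N100 w' okS szS ltg ltD box_Dl.
have var0 : ev [:: inp] (V 0) inp 1 by apply: ev_var.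
rewrite -/out encts -enc_termsE /w' -enc_instanceE -/inp in call.
have [t run le_t] := ev_call (isT : (f_main < size decoder)%N) var0 call.
exists ts, t; split=> //.
  have -> : (value_size inp ^ 48 = N * N ^ 15)%N by rewrite -expnS /N -expnM.
  rewrite mul1n; apply: leq_trans le_t _; rewrite /pw -lock.
  have : (1 <= N ^ 15)%N by rewrite expn_gt0 (leq_trans _ N100).
  by have : (100 * N ^ 15 <= N * N ^ 15)%N by [rewrite leq_mul2r N100 orbT]; lia.
move=> mu [_ minD] [C [p span_p Cp] close].
have ptsE x : (poly_of_terms ts).@[tnth x] = terms_eval out (rev x).
  rewrite /poly_of_terms /ts big_map raddf_sum /terms_eval /= big_seq [RHS]big_seq.
  apply: eq_bigr => u /out_supp[a _ Eu].
  by rewrite mevalZ Eu {1}/rev_mnm revK mnm_listK mono_eval_rev_mnm.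
split.
  rewrite /poly_of_terms /ts big_map; apply: (in_span_sum (f := fun u => list_mnm m (rev u.1))).
  by move=> u /out_supp[a Da ->]; rewrite /rev_mnm revK mnm_listK.
pose c b := p@_(list_mnm m (rev b)).
pose D' := [seq rev_mnm a | a <- D].
have CE : {in points S, forall x : m.-tuple F, comb D' c (rev x) = C x}.
  by move=> x /Cp ->; apply: meval_comb.
have correct : forall y, size y = size (rev S) -> terms_eval out y = comb D' c y.
  (* Since [dist_grid] is twice [wdist], the radius mu / 2 becomes rho = mu. *)
  rewrite /out revDl; apply: (@decode_correct _ _ _ _ _ mu%:R).
  - by rewrite all_rev; apply/allP=> _ /tnthP[i ->]; have [] := gridS i.
  - by rewrite map_inj_uniq //; apply: rev_mnm_inj.
  - by rewrite -revDl.
  - move=> b _ /mapP[a Da ->] le_b.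
    have szb : size (rev b) = m.
      by move: le_b; rewrite all2E size_rev => /andP[/eqP-> _]; rewrite size_rev size_mnm_list.
    have {le_b}: all2 leq (rev b) (mnm_list a).
      move: le_b; rewrite !all2E !size_rev => /andP[/eqP eq_sz le_b].
      by rewrite eq_sz eqxx -[mnm_list a]revK -rev_zip ?all_rev // size_rev.
    rewrite all2E => /andP[_ /(all_nthP (0, 0)%N) le_b].
    apply/mapP; exists (list_mnm m (rev b)); last by rewrite /rev_mnm list_mnmK // revK.
    apply: downD Da _; apply/mnm_lepP => i; rewrite mnmE -nth_mnm_list.
    have := le_b i; rewrite size_zip szb size_mnm_list minnn ltn_ord nth_zip /=.
      exact.
    by rewrite szb size_mnm_list.
  - by rewrite grid_points => _ /mapP[x px ->]; rewrite /w' list_wordE wt.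
  - move=> c0; rewrite grid_points has_map count_map => nz0.
    (* Any coefficients on the exponents in D are those of a polynomial spanned by D, so the minimum
       distance applies to every combination. *)
    rewrite ler_nat; apply: (minD (fun x => comb D' c0 (rev x))); last exact/hasP.
    exists (list_poly D c0) => [|x _]; last by rewrite meval_list_poly.
    exact: in_span_sum.
  rewrite -(wdist_grid S w (g := fun x => comb D' c (rev x))) //.
  by rewrite (eq_in_wdist w CE) mulrC -ltr_pdivlMr.
rewrite (eq_in_wdist w (h := C)) // => x px.
by rewrite ptsE correct ?CE // !size_rev !size_tuple.
Qed.
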